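(* Let $S$ be a finitely generated polynomial semigroup with unique minimal generating set $\mathcal{G}_S$, and put $C^*[S]:=\{c\in\mathbb{C}: g'(c)=0\text{ for some }g\in\mathcal{G}_S\}$, $C[S]:=\{c\in J(S): g'(c)=0\text{ for some }g\in\mathcal{G}_S\}$. Suppose $S$ satisfies the property that if $\sharp C^*[S]=1$ then $C[S]\cap\mathcal{E}(S)=\emptyset$. Then, for any finite set of generators $\mathcal{G}$ of $S$, the logarithmic potential $U^{\mu_{\mathcal{G}}}$ of the Dinh--Sibony measure $\mu_{\mathcal{G}}$ associated with $(S,\mathcal{G})$ is finite and continuous on $\mathbb{C}$.
   Context: Semigroups. Let $\widehat{\mathbb{C}}$ be the Riemann sphere. A rational semigroup is a subsemigroup (under composition) of the semigroup of holomorphic self-maps of $\widehat{\mathbb{C}}$ containing no constant maps. A rational semigroup $S$ is a polynomial semigroup if all its elements are polynomials, any degree-one element of $S$ has an attracting fixed point at $\infty$ (i.e., is $z\mapsto az+b$ with $|a|>1$), and $S$ contains at least one element of degree at least $2$. A set $\mathcal{G}\subseteq S$ generates $S$ if every element of $S$ is a finite (nonempty) composition of elements of $\mathcal{G}$. A finite generating set $\{g_1,\dots,g_N\}$ is minimal if no $g_i$ can be expressed as a composition of the remaining generators; every finitely generated polynomial semigroup $S$ has a unique minimal generating set, denoted $\mathcal{G}_S$. The Fatou set $F(S)$ is the largest open subset of $\widehat{\mathbb{C}}$ on which the functions in $S$ form a normal family, and the Julia set is $J(S):=\widehat{\mathbb{C}}\setminus F(S)$ (for finitely generated polynomial semigroups,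 $J(S)$ is a compact subset of $\mathbb{C}$). A point $z\in\widehat{\mathbb{C}}$ is exceptional if the set $\{x\in\widehat{\mathbb{C}}: g(x)=z\text{ for some }g\in S\}$ is finite; $\mathcal{E}(S)$ is the set of exceptional points. Dinh--Sibony measure. Let $\mathcal{G}=\{g_1,\dots,g_N\}$ be a finite set of generators of $S$ (distinct $g_i$) and $D:=\sum_{i=1}^N\deg(g_i)$ (so $D>N$). For $a\in\widehat{\mathbb{C}}$ put $$\mu_n^a:=\frac{1}{D^n}\sum_{(i_1,\dots,i_n)\in\{1,\dots,N\}^n}\ \sum_{x\in (g_{i_n}\circ\dots\circ g_{i_1})^{-1}\{a\}^{\bullet}}\delta_x,$$ where $\bullet$ means that preimages are repeated according to multiplicity. By a theorem of Dinh and Sibony, there exist a Borel polar set $E(\mathcal{G})\subsetneq\widehat{\mathbb{C}}$ (polar: of zero logarithmic capacity) and a regular Borel probability measure $\mu_{\mathcal{G}}$ on $\widehat{\mathbb{C}}$ such that $\mu_n^a\to\mu_{\mathcal{G}}$ in the weak* topology as $n\to\infty$ for every $a\in\widehat{\mathbb{C}}\setminus E(\mathcal{G})$. The measure $\mu_{\mathcal{G}}$ is the Dinh--Sibony measure associated with $(S,\mathcal{G})$; its support is contained in $J(S)$. Logarithmic potential. For a Borel probability measure $\sigma$ on $\mathbb{C}$ with compact support, $U^{\sigma}:\mathbb{C}\to(-\infty,\infty]$ is $U^{\sigma}(z):=\int_{\mathbb{C}}\log\frac{1}{|z-t|}\,d\sigma(t)$. *)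

(* Defs.v *)
From HB Require Import structures.
From mathcomp Require Import all_boot all_order all_algebra finmap.
From mathcomp Require Import all_classical all_reals all_analysis.
From mathcomp Require Import complex.

Set Implicit Arguments.
Unset Strict Implicit.
Unset Printing Implicit Defensive.

Import Order.TTheory GRing.Theory Num.Theory.
Import numFieldNormedType.Exports.

Local Open Scope classical_set_scope.
Local Open Scope ring_scope.

(* The standard normed topology of the complex plane. *)
HB.instance Definition _ (R : realType) := NormedModule.copy R[i] R[i]^o.

(* Real-valued modulus; the norm [`|z|] of [R[i]] takes its values in [R[i]]. *)
Notation cmod := ComplexField.Normc.normc.

(* [Some z] is the finite point z and [None] is the point at infinity. *)
Notation sphere R := (one_point_compactification R[i]).

Notation borel T := (g_sigma_algebraType (@open T)).

Section RiemannSphere.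
Variable R : realType.
Implicit Types (p : {poly R[i]}) (x y : sphere R).

(* A nonconstant polynomial as a self-map of the sphere. *)
Definition sphere_map p x : sphere R :=
  if x is Some z then Some p.[z] else None.

(* The spherical metric compatible with the topology of [sphere R]. *)
Definition chordal x y : R :=
  match x, y with
  | Some z, Some w =>
      2 * cmod (z - w) /
        (Num.sqrt (1 + cmod z ^+ 2) * Num.sqrt (1 + cmod w ^+ 2))
  | Some z, None | None, Some z => 2 / Num.sqrt (1 + cmod z ^+ 2)
  | None, None => 0
  end.

(* Every sequence has a subsequence converging locally uniformly on U with
   respect to the spherical metric; the limit may take the value infinity, and
   its values outside U are irrelevant. *)
Definition normal_on (U : set (sphere R)) (F : set (sphere R -> sphere R)) :=
  forall f : nat -> sphere R -> sphere R, (forall n, F (f n)) ->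
  exists (phi : nat -> nat) (h : sphere R -> sphere R),
    {homo phi : m n / (m < n)%N} /\
    forall K, compact K -> K `<=` U ->
    forall e : R, 0 < e ->
    \forall n \near \oo, forall x, K x -> chordal (f (phi n) x) (h x) < e.

End RiemannSphere.

Section PolynomialSemigroups.
Variable R : realType.
Local Notation C := (R[i]).
Implicit Types (S A : set {poly C}) (G : {fset {poly C}}) (p g : {poly C}).

Definition degree p := (size p).-1.

(* The composition g_n o ... o g_1 of the word [:: g_1; ...; g_n]. *)
Definition word_comp (w : seq {poly C}) : {poly C} :=
  foldl (fun h g => g \Po h) 'X w.

(* Distinct polynomials are distinct as maps, so a semigroup of polynomial
   maps is given as a set of polynomials closed under composition. *)
Definition polynomial_semigroup S :=
  [/\ forall p q, S p -> S q -> S (p \Po q),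
      forall p, S p -> (0 < degree p)%N,
      forall p, S p -> degree p = 1%N -> 1 < cmod (lead_coef p)
    & exists2 p, S p & (2 <= degree p)%N].

Definition compositions A : set {poly C} :=
  [set p | exists w : seq {poly C},
    [/\ w != [::], forall g, g \in w -> A g & p = word_comp w]].

Definition generates S G :=
  [set` G] `<=` S /\ S `<=` compositions [set` G].

Definition minimal_generating_set S G :=
  generates S G /\ forall g, g \in G -> ~ compositions ([set` G] `\ g) g.

Definition fatou S : set (sphere R) :=
  \bigcup_(U in [set U | open U /\
                         normal_on U [set sphere_map p | p in S]]) U.

Definition julia S : set (sphere R) := ~` fatou S.

Definition exceptional S : set (sphere R) :=
  [set z | finite_set [set x | exists2 g, S g & sphere_map g x = z]].

Definition critical_points G : set C :=
  [set c | exists2 g, g \in G & (g^`()).[c] = 0].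

Definition julia_critical_points S G : set C :=
  critical_points G `&` [set c | julia S (Some c)].

End PolynomialSemigroups.

Section PlanePart.
Variables (R : realType) (mu : {measure set (borel (sphere R)) -> \bar R}).

(* A Borel measure on the sphere viewed as a Borel measure on the plane. *)
Definition plane_part (A : set (borel R[i])) : \bar R :=
  mu ((Some : R[i] -> sphere R) @` A).

Let plane_part0 : plane_part set0 = 0%E.
Proof. by rewrite /plane_part image_set0 measure0. Qed.

Let plane_part_ge0 A : (0 <= plane_part A)%E.
Proof. exact: measure_ge0. Qed.

Lemma measurable_plane (A : set (borel R[i])) : measurable A ->
  measurable ((Some : R[i] -> sphere R) @` A : set (borel (sphere R))).
Proof.
pose M := [set B : set R[i] |
  measurable ((Some : R[i] -> sphere R) @` B : set (borel (sphere R)))].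
have oM U : open U -> M U.
  move=> oU; apply: sub_sigma_algebra.
  exact: (@one_point_compactification_open_some R[i]).
suff : <<s @open R[i] >> `<=` M by apply.
apply: smallest_sub => //; split=> [|B MB|F MF].
- by rewrite /M/= image_set0; exact: measurable0.
- rewrite setTD.
  rewrite /M/=.
  have -> : (Some : R[i] -> sphere R) @` (~` B) =
      (Some @` [set: R[i]]) `\` (Some @` B).
    rewrite eqEsubset; split=> x /=.
      move=> [z nBz <-]; split; first by exists z.
      by move=> [w Bw [wz]]; apply: nBz; rewrite -wz.
    move=> [[z _ <-] nB]; exists z => // Bz; apply: nB; by exists z.
  apply: measurableD => //; exact: (oM _ openT).
- rewrite /M/= image_bigcup; exact: bigcupT_measurable.
Qed.

Let plane_part_sigma_additive : semi_sigma_additive plane_part.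
Proof.
move=> F mF tF mUF; rewrite /plane_part image_bigcup.
apply: measure_semi_sigma_additive => //.
- by move=> i; apply: measurable_plane; exact: mF.
- apply/trivIsetP => i j _ _ ij; rewrite -subset0 => x /= [[z Fz <-]].
  move=> [w Fw [wz]]; move/trivIsetP: tF => /(_ i j I I ij).
  by rewrite -subset0 => /(_ z); apply; split=> //; rewrite -wz.
- by rewrite -image_bigcup; exact: measurable_plane.
Qed.

HB.instance Definition _ := isMeasure.Build _ _ _ plane_part
  plane_part0 plane_part_ge0 plane_part_sigma_additive.

End PlanePart.

Section LogarithmicPotential.
Variable R : realType.
Implicit Type sigma : {measure set (borel R[i]) -> \bar R}.
Local Open Scope ereal_scope.

(* The kernel is +oo at t = z. *)
Definition log_potential sigma (z : R[i]) : \bar R :=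
  \int[sigma]_t lne (cmod (z - t))%:E^-1.

Definition log_energy sigma : \bar R :=
  \int[sigma]_z log_potential sigma z.

(* The supremum of exp(-I(sigma)) over the Borel probability measures sigma
   with compact support in E, where I is the logarithmic energy; the capacity
   is 0 if there is no such measure. *)
Definition log_capacity (E : set R[i]) : \bar R :=
  ereal_sup (0 |` [set c | exists (sigma : probability (borel R[i]) R) K,
    [/\ compact K, K `<=` E, sigma K = 1 &
        c = expeR (- log_energy sigma)]]).

(* The point at infinity is polar. *)
Definition polar (E : set (sphere R)) :=
  log_capacity [set z | E (Some z)] = 0.

End LogarithmicPotential.

Section DinhSibony.
Variable R : realType.
Local Notation C := (R[i]).
Implicit Types (G : {fset {poly C}}) (p : {poly C}) (a : sphere R).
Local Open Scope ereal_scope.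

(* Preimages repeated according to multiplicity; infinity is its only
   preimage, with multiplicity deg p. *)
Definition preimages p a : seq (sphere R) :=
  if a is Some c then map Some (sval (closed_field_poly_normal (p - c%:P)%R))
  else nseq (degree p) None.

Definition total_degree G : nat := (\sum_(g <- G) degree g)%N.

Definition ds_iterate G (n : nat) a (A : set (borel (sphere R))) : \bar R :=
  ((total_degree G ^ n)%:R^-1)%:E *
  \sum_(w : n.-tuple G)
    \sum_(x <- preimages (word_comp (map val w)) a)
      \d_(x : borel (sphere R)) A.

Section Measure.
Variables (G : {fset {poly C}}) (n : nat) (a : sphere R).

Lemma ds_iterateE : exists (k : {nonneg R}) (s : seq (borel (sphere R))),
  ds_iterate G n a =
  mscale k (msum (fun i => \d_(nth (None : borel (sphere R)) s i)) (size s)).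
Proof.
have c0 : (0 <= (total_degree G ^ n)%:R^-1 :> R)%R by rewrite invr_ge0 ler0n.
exists (NngNum c0).
set s := flatten [seq (preimages (word_comp (map val w)) a :
                         seq (borel (sphere R)))
                 | w : n.-tuple G <- index_enum (n.-tuple G : finType)].
exists s; apply/funext => A; rewrite /ds_iterate /mscale /msum; congr (_ * _).
transitivity (\sum_(x <- s) (\d_x A : \bar R)).
  by rewrite big_flatten big_map.
by rewrite (big_nth (None : borel (sphere R))) big_mkord.
Qed.

Let ds_iterate0 : ds_iterate G n a set0 = 0.
Proof. by have [k [s ->]] := ds_iterateE; rewrite measure0. Qed.

Let ds_iterate_ge0 A : 0 <= ds_iterate G n a A.
Proof. by have [k [s ->]] := ds_iterateE; exact: measure_ge0. Qed.

Let ds_iterate_sigma_additive : semi_sigma_additive (ds_iterate G n a).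
Proof.
by have [k [s ->]] := ds_iterateE; exact: measure_semi_sigma_additive.
Qed.

HB.instance Definition _ := isMeasure.Build _ _ _ (ds_iterate G n a)
  ds_iterate0 ds_iterate_ge0 ds_iterate_sigma_additive.

End Measure.

Definition regular_measure (mu : {measure set (borel (sphere R)) -> \bar R}) :=
  forall A : set (borel (sphere R)), measurable A ->
    mu A = ereal_inf [set mu U | U in [set U : set (sphere R) |
                                        open U /\ A `<=` U]] /\
    mu A = ereal_sup [set mu K | K in [set K : set (sphere R) |
                                        compact K /\ K `<=` A]].

Definition dinh_sibony_measure G (mu : probability (borel (sphere R)) R) :=
  regular_measure mu /\
  exists E : set (borel (sphere R)),
    [/\ measurable E, polar E, E <> setT &
      forall a, ~ E a ->
      forall f : sphere R -> R, continuous f ->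
        \int[ds_iterate G n a]_x (f x)%:E @[n --> \oo] -->
        \int[mu]_x (f x)%:E].

End DinhSibony.

(* Main.v *)
(** Let [N] be the number of generators and [D > N] their total degree. With
    [L y = ln (1 + |y|)], the averages [V_n y = D^-n \sum_w L (g_w y)] over the words
    of length [n] converge uniformly, since their increments are [O((N / D)^n)]; the
    limit [V] is continuous, and it suffices to find a constant [c] such that
    [U^mu = c - V].
    The logarithmic kernel is regularised by averaging it over the horizontal segment
    [z + r [0, 1]]: [F t = \int_0^1 ln |z + r x - t| dx] is continuous in [t], so weak
    convergence of the [mu_n^a] applies to it once tightness is known. Summing [F] over
    the preimages of [a] gives the average of [V_n] over the segment, up to an additive
    constant and an error due to the points of the segment where [g_w] is close to [a].
    By Tonelli the integral of this error over [a] in [0, 1] is [O((N / D)^n)]; as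
    compact sets of positive Lebesgue measure are not polar, some [a] in [0, 1] lies
    outside the polar set and has errors tending to 0. Hence [\int F dmu] is the
    average of [V] over the segment minus [c]. Letting [r] tend to 0, by Fatou's lemma
    and dominated convergence, gives the identity. *)
Require Import Defs.
From HB Require Import structures.
From mathcomp Require Import all_boot all_order all_algebra finmap.
From mathcomp Require Import all_classical all_reals all_analysis.
From mathcomp Require Import complex measurable_realfun.
From mathcomp Require Import ring lra.

Set Implicit Arguments.
Unset Strict Implicit.
Unset Printing Implicit Defensive.

Import Order.TTheory GRing.Theory Num.Theory.
Import numFieldNormedType.Exports.
Import ComplexField.Normc.

Local Open Scope classical_set_scope.
Local Open Scope ring_scope.

(** * The topology of the complex plane *)

Section ComplexPlane.
Variable R : realType.
Local Notation C := R[i].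
Implicit Types z w t : C.

Lemma cmod_ge0 z : 0 <= cmod z.
Proof. by case: z => a b; exact: sqrtr_ge0. Qed.

Lemma norm_cmod z : `|z| = (cmod z)%:C%C.
Proof. by case: z => a b; rewrite normc_def. Qed.

Lemma cmodBC z w : cmod (z - w) = cmod (w - z).
Proof. by rewrite -normcN opprB. Qed.

Lemma cmodB_triangle w z t : cmod (z - t) <= cmod (z - w) + cmod (w - t).
Proof. by rewrite (le_trans _ (le_normcD _ _))// addrA subrK. Qed.

Lemma cmod_dist z w : `|cmod z - cmod w| <= cmod (z - w).
Proof.
rewrite ler_norml; apply/andP; split.
- have := le_normcD (w - z) z; rewrite subrK cmodBC; lra.
- have := le_normcD (z - w) w; rewrite subrK; lra.
Qed.

Lemma Re_le_cmod z : `|complex.Re z| <= cmod z.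
Proof. by have := normc_ge_Re z; rewrite norm_cmod lecR. Qed.

Lemma cmod_real (x : R) : cmod (x%:C%C) = `|x|.
Proof. by rewrite /= expr0n/= addr0 sqrtr_sqr. Qed.

Lemma cmod0 : cmod (0 : C) = 0. Proof. exact: normc0. Qed.

Lemma cmod_gt0 z : z != 0 -> 0 < cmod z.
Proof.
by move=> z0; rewrite lt_neqAle cmod_ge0 andbT eq_sym; apply: contra z0 => /eqP/eq0_normc/eqP.
Qed.

Lemma nbhs_cmod z (A : set C) :
  nbhs z A <-> exists2 e : R, 0 < e & forall w, cmod (z - w) < e -> A w.
Proof.
split.
(* In the order of [R[i]], a positive radius has zero imaginary part. *)
- move=> /nbhs_ballP[[e e'] /= e0 zeA]; move: e0; rewrite ltcE/= => /andP[/eqP e'0 e0].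
  exists e => // w zw; apply: zeA; rewrite /ball/= norm_cmod ltcE/=.
  by rewrite e'0 eqxx.
- move=> [e e0 zeA]; apply/nbhs_ballP; exists (e%:C%C); first by rewrite /= ltcR.
  by move=> w; rewrite /ball/= norm_cmod ltcR; exact: zeA.
Qed.

Lemma continuous_cmodP (f : C -> R) (z : C) :
  {for z, continuous f} <->
  forall e : R, 0 < e -> exists2 d : R, 0 < d &
    forall w, cmod (z - w) < d -> `|f z - f w| < e.
Proof.
have FF : Filter (nbhs z) by exact: nbhs_filter.
split=> [cf e e0|cf].
  by apply/nbhs_cmod; move/cvgrPdist_lt : cf; exact.
by apply/(@cvgrPdist_lt _ _ _ (nbhs z) _ f (f z)) => e e0; apply/nbhs_cmod; exact: cf.
Qed.

Lemma continuous_cmod_lip (f : C -> R) (k : R) :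
  (forall z w, `|f z - f w| <= k * cmod (z - w)) -> continuous f.
Proof.
move=> fk z; apply/continuous_cmodP => e e0.
have k0 : 0 < `|k| + 1 by rewrite ltr_wpDl.
exists (e / (`|k| + 1)); first by rewrite divr_gt0.
move=> w H.
rewrite (le_lt_trans (fk z w))// (@le_lt_trans _ _ ((`|k| + 1) * cmod (z - w)))//.
  by rewrite ler_wpM2r ?cmod_ge0//; have := ler_norm k; lra.
by rewrite mulrC -ltr_pdivlMr.
Qed.

Lemma continuous_cmod : continuous (@cmod R : C -> R).
Proof.
by apply: (@continuous_cmod_lip _ 1) => z w; rewrite mul1r; exact: cmod_dist.
Qed.

Lemma continuous_Re : continuous (@complex.Re R : C -> R).
Proof.
apply: (@continuous_cmod_lip _ 1) => z w; rewrite mul1r.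
by have := Re_le_cmod (z - w); case: z w => a b [c d].
Qed.

Lemma continuous_horner (p : {poly C}) : continuous (horner p : C -> C).
Proof.
elim/poly_ind: p => [|p c IH] z; have FF : ProperFilter (nbhs z) by exact: nbhs_pfilter.
  by rewrite (_ : horner 0 = cst 0); [exact: cvg_cst|apply/funext=> x; rewrite horner0].
rewrite (_ : horner _ = fun x => p.[x] * x + c); last first.
  by apply/funext=> x; rewrite hornerMXaddC.
by apply: cvgD; [apply: cvgM; [exact: IH|exact: cvg_id]|exact: cvg_cst].
Qed.

Lemma continuous_real_complex : continuous (@real_complex_def R (Phant R) : R -> C).
Proof.
move=> x A /nbhs_cmod[e e0 eA]; apply/nbhs_ballP; exists e => //= y.
by rewrite /ball/= => xy; apply: eA; rewrite -rmorphB cmod_real.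
Qed.

(** The disc is a closed subset of the image of the square [-r, r]^2 under the continuous map (x, y)
    -> x + iy. *)
Lemma compact_disc (r : R) : compact [set z : C | cmod z <= r].
Proof.
pose J := `[- r, r]%classic : set R.
pose h (u : R * R) : C := Complex u.1 u.2.
have ch : continuous h.
  move=> [a b] A /nbhs_cmod[e e0 eA].
  exists (ball a (e / 2), ball b (e / 2)).
    by split; apply: nbhsx_ballx; rewrite divr_gt0.
  move=> [x y] [/= ax yb]; apply: eA; rewrite /h/=.
  change (cmod (Complex a b - Complex x y) < e).
  have -> : Complex a b - Complex x y = (a - x)%:C%C + ('i * (b - y)%:C)%C.
    by apply/eqP; rewrite eq_complex/=; apply/andP; split; apply/eqP; ring.
  rewrite (le_lt_trans (le_normcD _ _))// normcM !cmod_real.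
  rewrite /= expr0n/= add0r expr1n sqrtr1 mul1r.
  by rewrite [e]splitr ltrD.
have cJ : compact (h @` (J `*` J)).
  apply: continuous_compact; first exact: continuous_subspaceT.
  by apply: compact_setX; exact: segment_compact.
apply: (subclosed_compact _ cJ).
- rewrite (_ : [set z | _] = (@cmod R : C -> R) @^-1` [set x | x <= r])//.
  by apply: closed_comp => [z _|]; [exact: continuous_cmod|exact: closed_le].
- move=> [a b] /= rz; exists (a, b) => //; split => /=.
  + have := Re_le_cmod (Complex a b) => /= ar.
    by rewrite /J/= in_itv/= -ler_norml (le_trans ar).
  + rewrite /J/= in_itv/= -ler_norml (le_trans _ rz)// -sqrtr_sqr.
    by rewrite ler_sqrt ?lerDr ?sqr_ge0// addr_ge0 ?sqr_ge0.
Qed.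

Lemma borel_measurable_fun (T : ptopologicalType) (f : T -> R) : continuous f ->
  measurable_fun setT (f : borel T -> R).
Proof.
move=> cf; apply: (measurability _ (RGenOpens.measurableE R)) => _ [_ [a [b ->]] <-].
rewrite setTI; apply: sub_sigma_algebra.
by move/continuousP : cf; apply; exact: interval_open.
Qed.
End ComplexPlane.

(** * Logarithmic singularities *)

Section LogSingularity.
Variable R : realType.
Implicit Types u v x b h : R.
Local Open Scope ereal_scope.

Let slab k : set R := `[(- (2 ^ k)%:R^-1)%R, ((2 ^ k)%:R^-1)%R]%classic.

Let mslab k : measurable (slab k).
Proof. exact: measurable_itv. Qed.

(** A dyadic substitute for log (1 / |u|): it counts the intervals [-2^-k, 2^-k] that contain [u].
    It is infinite at 0, dominates [- ln u] for u >= 0, and its integral reduces to a geometric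
    series. *)
Definition ell u : \bar R := \sum_(k <oo) (\1_(slab k) u)%:E.

Let ell_term_ge0 u k : 0 <= (\1_(slab k) u)%:E :> \bar R.
Proof. by rewrite lee_fin. Qed.

Lemma ell_ge0 u : 0 <= ell u.
Proof. by apply: nneseries_ge0 => k _ _; exact: ell_term_ge0. Qed.

Lemma measurable_ell : measurable_fun [set: R] ell.
Proof.
apply: ge0_emeasurable_sum => [k u _ _|k _]; first exact: ell_term_ge0.
by apply/measurable_EFinP/measurable_indic; exact: mslab.
Qed.

Lemma le_ell u v : (`|u| <= `|v|)%R -> ell v <= ell u.
Proof.
move=> uv; apply: lee_nneseries => k *; first exact: ell_term_ge0.
rewrite lee_fin !indicE ler_nat; case: (boolP (v \in slab k)) => //.
rewrite !inE /slab/= !in_itv/= -!ler_norml => vk.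
by rewrite mem_set//= in_itv/= -ler_norml (le_trans uv).
Qed.

(** The intervals of index 0 to [m] all contain [u], whence the count [m.+1]. *)
Lemma ell_ge_nat m u : (`|u| <= (2 ^ m)%:R^-1)%R -> m.+1%:R%:E <= ell u.
Proof.
move=> um; apply: le_trans (nneseries_lim_ge m.+1 _) => //.
rewrite big_mkord (eq_bigr (fun=> 1)).
  by rewrite sumEFin big_const_ord iter_addr_0.
move=> k _; rewrite indicE mem_set//= /slab/= in_itv/= -ler_norml (le_trans um)//.
by rewrite lef_pV2 ?posrE ?ltr0n ?expn_gt0// ler_nat leq_pexp2l// -ltnS.
Qed.

Lemma ell0 : ell 0%R = +oo.
Proof.
apply/eqyP => A A0; apply: (@le_trans _ _ (Num.truncn A).+1%:R%:E).
  by rewrite lee_fin ltW// truncnS_gt.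
by apply: ell_ge_nat; rewrite normr0 invr_ge0 ler0n.
Qed.

(** With [m] the integer part of [- ln u] when this is nonnegative, u <= e^-m <= 2^-m, so [ell u] is
    at least m + 1 > - ln u. The value at 0 is infinite, and a negative left side is trivial. *)
Lemma ln_le_ell u : (0 <= u)%R -> (- ln u)%:E <= ell u.
Proof.
rewrite le_eqVlt => /predU1P[<-|u0]; first by rewrite ell0 leey.
have [/= lu|lu] := lerP 0 (- ln u); last first.
  by rewrite (le_trans _ (ell_ge0 _))// lee_fin ltW.
have /andP[l1 l2] := truncn_itv lu; set m := Num.truncn _ in l1 l2.
apply: (@le_trans _ _ m.+1%:R%:E); first by rewrite lee_fin ltW.
apply: ell_ge_nat; rewrite gtr0_norm// -(lnK u0) -[ln u]opprK expRN.
rewrite lef_pV2 ?posrE ?expR_gt0 ?ltr0n ?expn_gt0//.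
rewrite (@le_trans _ _ (expR m%:R))//; last by rewrite ler_expR.
rewrite -[X in expR X]mulr1 expRM_natl natrX lerXn2r ?nnegrE ?expR_ge0//.
by have := expR_ge1Dx (1 : R)%R; rewrite -natr1.
Qed.

Lemma lne_inv_le_ell u : (0 <= u)%R -> lne u%:E^-1 <= ell u.
Proof.
move=> u0; case: (eqVneq u 0%R) => [->|uN0]; first by rewrite ell0 leey.
have {}u0 : (0 < u)%R by rewrite lt_neqAle eq_sym uN0.
by rewrite inver (negbTE uN0) lneV// lne_EFin// -EFinN ln_le_ell// ltW.
Qed.

(* [maxr u d] regularizes the logarithm at scale [d]. *)
Lemma ln_max_ell u (d : R) : (0 <= u)%R -> (0 < d)%R ->
  (`|ln (Num.max u d) - ln u|)%:E <= ell (u / d).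
Proof.
move=> u0 d0; case: (eqVneq u 0%R) => [->|uN0]; first by rewrite mul0r ell0 leey.
have {}u0 : (0 < u)%R by rewrite lt_neqAle eq_sym uN0.
case: (leP u d) => ud; last by rewrite subrr normr0 ell_ge0.
rewrite -ln_div ?posrE// ger0_norm; last by rewrite ln_ge0// ler_pdivlMr// mul1r.
by rewrite -invf_div lnV ?posrE ?divr_gt0// ln_le_ell// divr_ge0// ltW.
Qed.

(** The k-th term integrates to at most 2 h / 2^k, the length of the rescaled interval, and these
    lengths add up to 4 h. *)
Lemma integral_ell (D : set R) b h : measurable D -> (0 < h)%R ->
  \int[lebesgue_measure]_(x in D) ell ((x - b) / h) <= (4 * h)%:E.
Proof.
move=> mD h0.
have mf : measurable_fun [set: R] (fun x : R => (x - b) / h)%R.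
  by apply: measurable_funM => //; exact: measurable_funB.
rewrite /ell integral_nneseries//; last first.
  move=> k; apply: measurable_funTS; apply/measurable_EFinP.
  apply: (@measurableT_comp _ _ _ _ _ _ (\1_(slab k) : R -> R) _ (fun x => (x - b) / h)%R) => //.
(* The length 2 h / 2^k is written 4 h / 2^(k+1) to fit this form of the geometric series. *)
have H := @cvg_geometric_eseries_half R (4 * h)%R 0.
rewrite expr0 divr1 in H; rewrite -(cvg_lim _ H)//.
apply: lee_nneseries => k; first by move=> _ _; apply: integral_ge0 => x _.
move=> _; rewrite addn1.
have slabE : [set x | slab k ((x - b) / h)%R] =
    `[(b - h / (2 ^ k)%:R)%R, (b + h / (2 ^ k)%:R)%R]%classic.
  apply/seteqP; split => x; rewrite /slab/= !in_itv/= ler_pdivlMr// ler_pdivrMr// mulNr [(_^-1 * h)%R]mulrC => /andP[A B]; apply/andP; split; lra.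
rewrite [leLHS](_ : _ = \int[lebesgue_measure]_(x in D)
    (\1_(`[(b - h / (2 ^ k)%:R)%R, (b + h / (2 ^ k)%:R)%R]%classic : set R) x)%:E); last first.
  by apply: eq_integral => x _; rewrite !indicE -slabE.
rewrite integral_indic//.
apply: (@le_trans _ _ (lebesgue_measure `[(b - h / (2 ^ k)%:R)%R, (b + h / (2 ^ k)%:R)%R]%classic)).
  by apply: le_measure; rewrite ?inE//; exact: measurableI.
rewrite lebesgue_measure_itv/= lte_fin; case: ifPn => _; last first.
  by rewrite lee_fin divr_ge0// mulr_ge0// ltW.
rewrite -EFinB lee_fin expnS natrM invfM.
rewrite le_eqVlt; apply/orP; left; apply/eqP; field.
by rewrite pnatr_eq0 -lt0n expn_gt0.
Qed.

End LogSingularity.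

(** * Averages of the logarithmic kernel over a segment *)

Section SegmentAverage.
Variable R : realType.
Local Notation C := R[i].
Local Notation leb := (@lebesgue_measure R).
Local Notation I01 := (`[0%R, 1%R]%classic : set R).
Implicit Types (z t : C) (r d x b h M : R) (f : R -> R).

Lemma unit_segment_measure : leb I01 = 1%E.
Proof. by rewrite lebesgue_measure_itv/= lte_fin ltr01 oppr0 adde0. Qed.

Lemma Rintegral_unit_cst M : \int[leb]_(x in I01) M = M.
Proof.
by rewrite Rintegral_cst//= lebesgue_measure_itv/= lte_fin ltr01 oppr0 addr0 mulr1.
Qed.

Lemma integrable_unit_cst M : leb.-integrable I01 (fun=> M%:E).
Proof.
apply: continuous_compact_integrable; first exact: segment_compact.
by move=> x; exact: cvg_cst.
Qed.

(** The common source of the integrability statements with a logarithmic singularity: a constant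
    plus one rescaled [ell] has an explicit integral bound, independent of the centre [b]. *)
Lemma ell_integral_le f M b h : measurable_fun I01 f -> 0 < h -> 0 <= M ->
  (forall x, I01 x -> ((`|f x|)%:E <= M%:E + ell ((x - b) / h))%E) ->
  (\int[leb]_(x in I01) `|(f x)%:E| <= (M + 4 * h)%:E)%E.
Proof.
move=> mf h0 M0 fM.
have mell : measurable_fun I01 (fun x => ell ((x - b) / h)).
  apply: (measurableT_comp (@measurable_ell R)).
  by apply: measurable_funTS; apply: measurable_funM => //; exact: measurable_funB.
apply: (@le_trans _ _ (\int[leb]_(x in I01) (M%:E + ell ((x - b) / h)))%E).
  apply: ge0_le_integral => //.
  - by apply: measurableT_comp => //; exact/measurable_EFinP.
  - by apply: emeasurable_funD.
rewrite ge0_integralD//; last by move=> x _; exact: ell_ge0.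
rewrite integral_cst//= [X in (M%:E * X)%E](_ : _ = 1%E); last exact: unit_segment_measure.
rewrite mule1 EFinD leeD2l//.
exact: integral_ell.
Qed.

Lemma ell_integrable f M b h : measurable_fun I01 f -> 0 < h -> 0 <= M ->
  (forall x, I01 x -> ((`|f x|)%:E <= M%:E + ell ((x - b) / h))%E) ->
  leb.-integrable I01 (fun x => (f x)%:E).
Proof.
move=> mf h0 M0 fM; apply/integrableP; split; first exact/measurable_EFinP.
by apply: le_lt_trans (ell_integral_le mf h0 M0 fM) _; rewrite ltry.
Qed.

Lemma ell_Rintegral_le f M b h : measurable_fun I01 f -> 0 < h -> 0 <= M ->
  (forall x, I01 x -> ((`|f x|)%:E <= M%:E + ell ((x - b) / h))%E) ->
  `|\int[leb]_(x in I01) f x| <= M + 4 * h.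
Proof.
move=> mf h0 M0 fM; have If := ell_integrable mf h0 M0 fM.
rewrite -lee_fin EFin_normr_Rintegral//.
apply: le_trans (ell_integral_le mf h0 M0 fM).
by apply: le_abse_integral => //; exact/measurable_EFinP.
Qed.

Definition segment z r x : C := z + (r * x)%:C%C.

Lemma continuous_segment z r : continuous (segment z r).
Proof.
move=> x A /nbhs_cmod[e e0 eA]; apply/nbhs_ballP.
exists (e / (`|r| + 1)); first by rewrite /= divr_gt0// ltr_wpDl.
move=> y; rewrite /ball/= => xy; apply: eA.
rewrite /segment opprD addrACA subrr add0r -rmorphB -mulrBr cmod_real normrM.
rewrite ltr_pdivlMr in xy; last by rewrite ltr_wpDl.
by rewrite (le_lt_trans _ xy)// mulrC ler_wpM2l// lerDl.
Qed.

Lemma integrable_segment (V : C -> R) z r : continuous V ->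
  leb.-integrable I01 (fun x => (V (segment z r x))%:E).
Proof.
move=> cV; apply: continuous_compact_integrable; first exact: segment_compact.
apply: continuous_subspaceT => x; apply: continuous_comp; last exact: cV.
exact: continuous_segment.
Qed.

Lemma measurable_segment (V : C -> R) z r D : continuous V ->
  measurable_fun D (V \o segment z r).
Proof.
move=> cV; apply: measurable_funTS; apply: continuous_measurable_fun => x.
by apply: continuous_comp; [exact: continuous_segment|exact: cV].
Qed.

Lemma segment_average_dist (U V : C -> R) z r M : continuous U -> continuous V ->
  (forall x, I01 x -> `|U (segment z r x) - V (segment z r x)| <= M) ->
  `|\int[leb]_(x in I01) U (segment z r x) - \int[leb]_(x in I01) V (segment z r x)| <= M.
Proof.
move=> cU cV UV; have IU := integrable_segment z r cU; have IV := integrable_segment z r cV.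
have I := integrableB _ IU IV.
rewrite -RintegralB//.
apply: le_trans (le_normr_Rintegral _ (I _)) _ => //.
rewrite -[leRHS]Rintegral_unit_cst; apply: le_Rintegral => //.
- exact: (integrable_norm (I _)).
- exact: integrable_unit_cst.
Qed.

(** Since the segment is horizontal, the real part of [segment z r x - t] is r (x - Re (t - z) / r).
    It is at most the modulus in absolute value, and [ell] decreases in |u|; the singularity thus
    becomes one-dimensional, at scale d / r. *)
Lemma ell_segment z t r d x : 0 < r -> 0 < d ->
  (ell (cmod (segment z r x - t)%R / d)%R <=
   ell ((x - complex.Re (t - z) / r) / (d / r))%R)%E.
Proof.
move=> r0 d0; apply: le_ell.
have -> : (x - complex.Re (t - z) / r) / (d / r) = complex.Re (segment z r x - t) / d.
  by case: z t => a b [a' b'] /=; field; rewrite !gt_eqF.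
by rewrite !normrM ler_wpM2r// [leRHS]ger0_norm ?cmod_ge0// Re_le_cmod.
Qed.

(** For r > 0 the segment meets [t] for at most one [x], where the convention [ln 0 = 0] replaces
    the value -oo without affecting the integral. *)
Definition segment_log z r t := \int[leb]_(x in I01) ln (cmod (segment z r x - t)).

(** Truncating the logarithm from below at [ln d] makes the average Lipschitz in [t], with constant
    1 / d. *)
Definition segment_logmax z r d t :=
  \int[leb]_(x in I01) ln (Num.max (cmod (segment z r x - t)) d).

(** For q <= p, ln p - ln q = ln (1 + (p - q) / q) <= (p - q) / q. *)
Lemma ln_lipschitz d p q : 0 < d -> d <= p -> d <= q ->
  `|ln p - ln q| <= `|p - q| / d.
Proof.
move=> d0; wlog qp : p q / q <= p.
  move=> H dp dq; case: (leP q p) => [|/ltW] qp; first exact: H.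
  by rewrite distrC (distrC p); exact: H.
move=> dp dq; have q0 := lt_le_trans d0 dq; have p0 := lt_le_trans d0 dp.
rewrite ger0_norm; last by rewrite subr_ge0 ler_ln.
rewrite ger0_norm; last by rewrite subr_ge0.
rewrite -ln_div ?posrE//.
have -> : p / q = 1 + (p - q) / q by field; rewrite gt_eqF.
rewrite (le_trans (le_ln1Dx _))//.
  by rewrite (lt_le_trans (ltrN10 _))// divr_ge0// ?subr_ge0// ltW.
by rewrite ler_wpM2l ?subr_ge0// lef_pV2 ?posrE.
Qed.

Lemma ln_max_lipschitz d p q : 0 < d ->
  `|ln (Num.max p d) - ln (Num.max q d)| <= `|p - q| / d.
Proof.
move=> d0; rewrite (le_trans (ln_lipschitz d0 _ _)) ?le_max ?lexx ?orbT//.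
rewrite ler_wpM2r ?invr_ge0 ?(ltW d0)//.
by rewrite !maxEle; case: ifPn => pd; case: ifPn => qd; rewrite ?subrr ?normr_ge0//;
   rewrite -?ltNge in pd qd; rewrite !ler_norml; apply/andP; split;
   have := ler_norm (p - q); have := ler_norm (q - p); rewrite (distrC q); lra.
Qed.

Lemma continuous_cmod_sub t : continuous (fun w : C => cmod (w - t)).
Proof.
apply: (@continuous_cmod_lip _ _ 1) => w w'; rewrite mul1r.
by rewrite (le_trans (cmod_dist _ _))// opprD addrACA subrr addr0.
Qed.

Lemma continuous_ln_max_cmod d t : 0 < d ->
  continuous (fun w : C => ln (Num.max (cmod (w - t)) d)).
Proof.
move=> d0; apply: (@continuous_cmod_lip _ _ d^-1) => w w'.
rewrite (le_trans (ln_max_lipschitz _ _ d0))// mulrC ler_wpM2l ?invr_ge0 ?(ltW d0)//.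
by rewrite (le_trans (cmod_dist _ _))// opprD addrACA subrr addr0.
Qed.

Lemma integrable_segment_logmax z r d t : 0 < d ->
  leb.-integrable I01 (fun x => (ln (Num.max (cmod (segment z r x - t)) d))%:E).
Proof.
move=> d0; exact: (@integrable_segment (fun w => ln (Num.max (cmod (w - t)) d)) _ _
  (@continuous_ln_max_cmod d t d0)).
Qed.

Lemma measurable_segment_log z r t (D : set R) :
  measurable_fun D (fun x => ln (cmod (segment z r x - t))).
Proof.
apply: (measurableT_comp (@measurable_ln R)).
exact: (@measurable_segment (fun w => cmod (w - t)) _ _ _ (@continuous_cmod_sub t)).
Qed.

Lemma segment_logmax_sub_ell z r d t x : 0 < r -> 0 < d ->
  ((`|ln (Num.max (cmod (segment z r x - t)%R) d) - ln (cmod (segment z r x - t)%R)|)%:E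
    <= 0%:E + ell ((x - complex.Re (t - z) / r) / (d / r))%R)%E.
Proof.
move=> r0 d0; rewrite add0e (le_trans (ln_max_ell _ d0)) ?cmod_ge0//.
exact: ell_segment.
Qed.

Let measurable_segment_logmax_sub z r d t : 0 < d ->
  measurable_fun I01 (fun x => ln (Num.max (cmod (segment z r x - t)) d) -
                               ln (cmod (segment z r x - t))).
Proof.
move=> d0; apply: measurable_funB; last exact: measurable_segment_log.
exact: (@measurable_segment (fun w => ln (Num.max (cmod (w - t)) d)) _ _ _ (@continuous_ln_max_cmod d t d0)).
Qed.

Lemma integrable_segment_log z r t : 0 < r ->
  leb.-integrable I01 (fun x => (ln (cmod (segment z r x - t)))%:E).
Proof.
move=> r0.
(* The logarithm is its truncation at scale 1 minus the truncation error, and both are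
   integrable. *)
have := ell_integrable (@measurable_segment_logmax_sub z r 1 t ltr01)
  (divr_gt0 ltr01 r0) (lexx 0) (fun x _ => segment_logmax_sub_ell z t x r0 ltr01).
move=> /(integrableB _ (integrable_segment_logmax z r t ltr01)) H.
apply: eq_integrable (H _) => // x _ /=.
by rewrite -EFinB opprB addrCA subrr addr0.
Qed.

(** The truncation error is bounded by [ell] at scale d / r. The bound is uniform in [t], so
    [segment_log] is a uniform limit of Lipschitz functions as d tends to 0. *)
Lemma segment_log_logmax z r d t : 0 < r -> 0 < d ->
  `|segment_logmax z r d t - segment_log z r t| <= 4 * (d / r).
Proof.
move=> r0 d0; rewrite /segment_logmax /segment_log -RintegralB//; last 2 first.
- exact: integrable_segment_logmax.
- exact: integrable_segment_log.
rewrite -[leRHS]add0r.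
apply: (ell_Rintegral_le (@measurable_segment_logmax_sub z r d t d0) (divr_gt0 d0 r0) (lexx 0)
  (fun x _ => segment_logmax_sub_ell z t x r0 d0)).
Qed.

Lemma segment_logmax_lip z r d t t' : 0 < d ->
  `|segment_logmax z r d t - segment_logmax z r d t'| <= cmod (t - t') / d.
Proof.
move=> d0; rewrite /segment_logmax -RintegralB//; try exact: integrable_segment_logmax.
apply: le_trans (le_normr_Rintegral _ _) _ => //.
  by have := integrableB _ (integrable_segment_logmax z r t d0)
    (integrable_segment_logmax z r t' d0); exact.
rewrite -[leRHS]Rintegral_unit_cst; apply: le_Rintegral => //.
- have := integrableB _ (integrable_segment_logmax z r t d0)
    (integrable_segment_logmax z r t' d0) => /(_ (measurable_itv _)).
  by move=> /integrable_norm.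
- exact: integrable_unit_cst.
move=> x _; rewrite (le_trans (ln_max_lipschitz _ _ d0))//.
rewrite ler_wpM2r ?invr_ge0 ?(ltW d0)// (le_trans (cmod_dist _ _))//.
by rewrite opprB addrC addrA subrK cmodBC.
Qed.

Lemma continuous_segment_log z r : 0 < r -> continuous (segment_log z r).
Proof.
move=> r0 t; apply/continuous_cmodP => e e0.
(* Each of the two truncation errors is then at most 4 d / r = e / 4, which leaves e / 2 for the
   Lipschitz part. *)
pose d := e * r / 16.
have d0 : 0 < d by rewrite /d divr_gt0// mulr_gt0.
exists (d * e / 2); first by rewrite divr_gt0// mulr_gt0.
move=> t' tt'.
have := segment_log_logmax z t r0 d0; have := segment_log_logmax z t' r0 d0.
have := segment_logmax_lip z r t t' d0.
have -> : 4 * (d / r) = e / 4 by rewrite /d; field; rewrite gt_eqF.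
have : cmod (t - t') / d < e / 2 by rewrite ltr_pdivrMr// [ltRHS]mulrC mulrA.
move: (segment_log z r t) (segment_log z r t') (segment_logmax z r d t)
  (segment_logmax z r d t') (cmod (t - t') / d) => a a' b b' c.
rewrite !ler_norml ltr_norml => A /andP[B1 B2] /andP[C1 C2] /andP[D1 D2].
apply/andP; split; lra.
Qed.

Lemma segment_dist z r x t : 0 <= r -> I01 x ->
  `|cmod (segment z r x - t) - cmod (z - t)| <= r.
Proof.
move=> r0; rewrite /= in_itv/= => /andP[x0 x1].
rewrite (le_trans (cmod_dist _ _))// /segment opprB addrA subrK addrC addKr.
by rewrite cmod_real ger0_norm ?mulr_ge0// ler_piMr.
Qed.

Lemma segment_log_le z r t : 0 < r -> segment_log z r t <= ln (cmod (z - t) + r).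
Proof.
move=> r0; apply/ler_addgt0Pl => e e0.
(* A direct pointwise comparison can fail where the segment meets [t], because [ln 0 = 0]; the
   truncated logarithm avoids this. The bound d <= r keeps the maximum below |z - t| + r, and 4 d /
   r <= e controls the error. *)
pose d := Num.min r (e * r / 4).
have d0 : 0 < d by rewrite /d lt_min r0 divr_gt0// mulr_gt0.
have := segment_log_logmax z t r0 d0; rewrite ler_norml => /andP[A _].
have : 4 * (d / r) <= e.
  rewrite mulrA ler_pdivrMr// -ler_pdivlMl// mulrC.
  by rewrite /d ge_min lexx orbT.
suff : segment_logmax z r d t <= ln (cmod (z - t) + r) by lra.
rewrite -[leRHS]Rintegral_unit_cst; apply: le_Rintegral => //.
- exact: integrable_segment_logmax.
- exact: integrable_unit_cst.
move=> x x01; rewrite ler_ln ?posrE.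
- rewrite ge_max; apply/andP; split.
    by have := segment_dist z t (ltW r0) x01; rewrite ler_norml => /andP[]; lra.
  by rewrite (@le_trans _ _ r) ?lerDr ?cmod_ge0// /d ge_min lexx.
- by rewrite lt_max d0 orbT.
- by rewrite ltr_wpDl// cmod_ge0.
Qed.

Lemma segment_log_ge_far z r t : 0 < r -> r < cmod (z - t) ->
  ln (cmod (z - t) - r) <= segment_log z r t.
Proof.
move=> r0 rt; rewrite -[leLHS]Rintegral_unit_cst; apply: le_Rintegral => //.
- exact: integrable_unit_cst.
- exact: integrable_segment_log.
move=> x x01.
have H : cmod (z - t) - r <= cmod (segment z r x - t).
  by have := segment_dist z t (ltW r0) x01; rewrite ler_norml => /andP[]; lra.
by rewrite ler_ln// ?posrE ?(lt_le_trans _ H)// subr_gt0.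
Qed.

(** The loss 8 does not depend on [r], which later gives a dominating function. If 2 r <= |z - t|,
    the segment stays at distance at least |z - t| / 2 from [t], and the loss is at most ln 2 <= 1.
    Otherwise truncation at 2 r costs 8, and the truncated logarithm is at least ln |z - t|. *)
Lemma segment_log_ge z r t : 0 < r -> 0 < cmod (z - t) ->
  ln (cmod (z - t)) - 8 <= segment_log z r t.
Proof.
move=> r0 t0; case: (lerP (2 * r) (cmod (z - t))) => rt.
  apply: le_trans (segment_log_ge_far r0 _); last by lra.
  have -> : cmod (z - t) = 2 * (cmod (z - t) / 2) by field.
  have h0 : 0 < cmod (z - t) / 2 by rewrite divr_gt0.
  rewrite lnM ?posrE//.
  have h : ln (cmod (z - t) / 2) <= ln (2 * (cmod (z - t) / 2) - r).
    by rewrite ler_ln ?posrE//; lra.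
  by have := @le_ln1Dx R 1; rewrite (_ : 1 + 1 = 2)//; lra.
have d0 : 0 < 2 * r by lra.
have := segment_log_logmax z t r0 d0; rewrite ler_norml => /andP[_].
have -> : 4 * (2 * r / r) = 8 by field; rewrite gt_eqF.
suff : ln (cmod (z - t)) <= segment_logmax z r (2 * r) t by lra.
rewrite -[leLHS]Rintegral_unit_cst; apply: le_Rintegral => //.
- exact: integrable_unit_cst.
- exact: integrable_segment_logmax.
move=> x _; rewrite ler_ln ?posrE//; last by rewrite lt_max d0 orbT.
by rewrite le_max (ltW rt) orbT.
Qed.

End SegmentAverage.

(** * Polar sets *)

Section PolarSets.
Variable R : realType.
Local Notation C := R[i].
Local Notation leb := (@lebesgue_measure R).
Local Notation I01 := (`[0%R, 1%R]%classic : set R).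
Local Open Scope ereal_scope.
Import HBNNSimple.

(* No measurability assumption: both sides are suprema over simple functions. *)
Lemma le_integral_measure d (T : measurableType d)
    (m1 m2 : {measure set T -> \bar R}) (f g : T -> \bar R) :
  (forall A, measurable A -> m1 A <= m2 A) ->
  (forall x, 0 <= g x) -> (forall x, f x <= g x) ->
  \int[m1]_x f x <= \int[m2]_x g x.
Proof.
move=> m12 g0 fg; rewrite [leRHS]ge0_integralTE// /integral !patch_setT.
apply: le_trans (geeDl _ _) _.
  rewrite oppe_le0; apply: ereal_sup_ubound; exists (cst_nnsfun T (@NngNum R 0 (lexx 0))).
    by move=> x /=; exact: funeneg_ge0.
  exact: sintegral0.
apply: ge_ereal_sup => _ [h hf <-]; apply: (@le_trans _ _ (sintegral m2 h)).
  exact: le_measure_sintegral.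
apply: ereal_sup_ubound; exists h => // x; rewrite (le_trans (hf x))//.
by rewrite funeposE ge_max fg g0.
Qed.

Definition real_point (x : measurableTypeR R) : borel C := x%:C%C.

Lemma measurable_real_point : measurable_fun setT real_point.
Proof.
apply: (@measurability _ _ _ (borel C) setT real_point (@open C)) => [//|_ [U oU <-]].
rewrite setTI.
by apply: open_measurable; move/continuousP : (@continuous_real_complex R); exact.
Qed.

HB.instance Definition _ := isMeasurableFun.Build _ _ _ _ _ measurable_real_point.

Lemma lne_cmod_le_ell (z t : C) :
  lne (cmod (z - t)%R)%:E^-1 <= ell ((complex.Re t - complex.Re z) / 1)%R.
Proof.
apply: le_trans (lne_inv_le_ell (cmod_ge0 _)) _; apply: le_ell.
rewrite divr1 [leRHS]ger0_norm ?cmod_ge0// distrC.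
by have := Re_le_cmod (z - t)%R; case: z t => a b [c d].
Qed.

Lemma mnormalizeE d (T : measurableType d) (m : {measure set T -> \bar R})
    (P : probability T R) A : 0 < m setT -> m setT < +oo ->
  mnormalize m P A = m A * (fine (m setT))^-1%:E.
Proof. by rewrite /mnormalize => m0 moo; rewrite gt_eqF// lt_eqF. Qed.

(** The normalised Lebesgue measure on [K], pushed to the real axis of the plane, has a potential
    bounded above by 4 / |K|. Its energy is therefore not +oo, and it witnesses positive
    capacity. *)
Lemma compact_capacity_gt0 (K : set R) : compact K -> 0 < leb K -> leb K < +oo ->
  0 < log_capacity [set x%:C%C | x in K].
Proof.
move=> cK K0 Koo; have mK := compact_measurable cK.
pose m := mrestr leb mK.
(* The Dirac mass is the fallback of [mnormalize] for a measure of mass 0 or infinity, which does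
   not occur here. *)
pose P : probability (measurableTypeR R) R := mnormalize m (dirac (0%R : measurableTypeR R)).
pose sigma : probability (borel C) R := distribution P (real_point : {mfun _ >-> _}).
have k0 : (0 < fine (leb K))%R by rewrite fine_gt0// K0.
have kE : (fine (leb K))%:E = leb K by rewrite fineK// ge0_fin_numE.
pose c : {nonneg R} := NngNum (ltW (eq_rect _ is_true k0 _ (esym (invr_gt0 (fine (leb K)))))).
have mT : m setT = leb K by rewrite /m /mrestr setTI.
have mT0 : 0 < m setT by rewrite mT.
have mToo : m setT < +oo by rewrite mT.
have PE A : P A = (m A * (fine (leb K))^-1%:E)%E.
  by rewrite -mT; exact: (mnormalizeE _ _ mT0 mToo).
have sK : sigma (real_point @` K) = 1.
  change (P (real_point @^-1` (real_point @` K)) = 1); rewrite PE /m /mrestr.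
  rewrite (_ : _ `&` K = K) ?kE.
    by rewrite -kE -EFinM divff// gt_eqF.
  by apply/seteqP; split => [x []//|x Kx]; split => //; exists x.
have bnd (z : C) : log_potential sigma z <= (4 / fine (leb K))%:E.
  pose g : borel C -> \bar R := fun t => ell ((complex.Re t - complex.Re z) / 1)%R.
  have mg : measurable_fun [set: borel C] g.
    apply: (measurableT_comp (@measurable_ell R)); apply: measurable_funM => //.
    apply: measurable_funB => //; apply: borel_measurable_fun.
    exact: continuous_Re.
  apply: (@le_trans _ _ (\int[sigma]_t g t)).
    by apply: le_integral_measure => // t; [exact: ell_ge0|exact: lne_cmod_le_ell].
  rewrite ge0_integral_distribution//; last by move=> t; exact: ell_ge0.
  (* [P] is dominated by [c] times Lebesgue measure, where c = 1 / |K|. *)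
  apply: (@le_trans _ _ (\int[mscale c leb]_x (g (real_point x)))).
    apply: le_integral_measure => [A mA|x|x]; [|exact: ell_ge0|by []].
    change (P A <= c%:num%:E * leb A); rewrite PE muleC lee_wpmul2l// ?lee_fin ?invr_ge0 ?(ltW k0)//.
    by rewrite /m /mrestr; apply: le_measure; rewrite ?inE//; exact: measurableI.
  rewrite ge0_integral_mscale//; last 2 first.
  - by apply: (measurableT_comp mg); exact: measurable_real_point.
  - by move=> x _; exact: ell_ge0.
  rewrite mulrC EFinM lee_wpmul2l ?lee_fin ?invr_ge0 ?(ltW k0)//.
  apply: le_trans (integral_ell _ measurableT ltr01) _.
  by rewrite mulr1.
apply: (@lt_le_trans _ _ (expeR (- log_energy sigma))).
  have : log_energy sigma <= (4 / fine (leb K))%:E.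
    rewrite -[leRHS]mule1 -(@probability_setT _ _ _ sigma) -integral_cst//.
    by apply: le_integral_measure => // z; rewrite lee_fin divr_ge0// ltW.
  by case: (log_energy sigma) => [e| |]//= _; rewrite lte_fin expR_gt0.
apply: ereal_sup_ubound; right; exists sigma, (real_point @` K); split => //.
apply: continuous_compact => //.
by apply: continuous_subspaceT; exact: continuous_real_complex.
Qed.

(** An integrable [F] is finite on a subset [T] of [0, 1] of full measure. If [T] were contained in
    [E], a compact part of [T] with positive length would contradict polarity. *)
Lemma polar_avoid (E : set (sphere R)) (F : R -> \bar R) : polar E ->
  measurable_fun I01 F -> (forall x, 0 <= F x) ->
  \int[leb]_(x in I01) F x < +oo ->
  exists a, [/\ I01 a, ~ E (Some a%:C%C) & F a < +oo].
Proof.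
move=> pE mF F0 iF; apply: contrapT => nex.
pose T := I01 `&` [set x | F x < +oo].
have TE x : T x -> E (Some x%:C%C).
  by move=> [x01 Fx]; apply: contrapT => nE; apply: nex; exists x.
have mT : measurable T by exact: emeasurable_fun_infty_o.
have IF : leb.-integrable I01 F.
  by apply/integrableP; split => //; under eq_integral do rewrite gee0_abs//.
have mI : (R.-ocitv.-measurable).-sigma.-measurable I01 by exact: measurable_itv.
have [N [mN N0 subN]] := integrable_ae mI IF.
have T1 : leb T = 1.
  apply/eqP; rewrite eq_le -{1}unit_segment_measure; apply/andP; split.
    by apply: le_measure; rewrite ?inE//; move=> x [].
  rewrite -(@unit_segment_measure R).
  apply: (@le_trans _ _ (leb (T `|` N))).
    apply: le_measure; rewrite ?inE//; first exact: measurableU.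
    move=> x x01; case: (pselect (N x)) => [|nN]; first by right.
    left; split => //=; rewrite ltNge; apply/negP => Fx; apply: nN; apply: subN => /=.
    by move=> /(_ x01); rewrite ge0_fin_numE// ltNge Fx.
  apply: le_trans (measureU2 _ _ _) _ => //.
  by rewrite [X in _ + X]N0 adde0.
have Too : leb T < +oo by rewrite T1 ltry.
(* [T] has measure 1, so inner approximation up to 1/2 leaves a compact set of positive measure. *)
have h0 : (0 < 2^-1 :> R)%R by rewrite invr_gt0.
have [K [cK KT TK]] := lebesgue_regularity_inner mT Too h0.
have mK := compact_measurable cK.
have K0 : 0 < leb K.
  rewrite lt_neqAle measure_ge0 andbT; apply/eqP => K0.
  have : leb T <= leb (T `\` K) + leb K.
    rewrite -measureU//; last 2 first.
    - exact: measurableD.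
    - by rewrite setDE -setIA setICl setI0.
    apply: le_measure; rewrite ?inE//; first by apply: measurableU => //; exact: measurableD.
    by move=> x Tx; case: (pselect (K x)); [right|left].
  rewrite T1 -K0 adde0 leNgt (lt_trans TK)//.
  by rewrite lte_fin invf_lt1// ltr1n.
have Koo : leb K < +oo.
  apply: (@le_lt_trans _ _ (leb T)) => //.
  by apply: le_measure; rewrite ?inE.
have := compact_capacity_gt0 cK K0 Koo; apply/negP; rewrite -leNgt.
(* Capacity is monotone, and the embedded [K] lies in [E]. *)
rewrite -pE; apply: le_ereal_sup => x [->|]; first by left.
move=> [sigma [L [cL LK sL ->]]]; right; exists sigma, L; split => //.
by move=> z /LK[y Ky <-]; apply: TE; exact: KT.
Qed.

End PolarSets.

(** * Growth of polynomials and their words *)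

Section PolynomialGrowth.
Variable R : realType.
Local Notation C := R[i].
Implicit Types (p q : {poly C}) (y x a : C).

(** The finite case of [preimages], as points of the plane, with multiplicity. *)
Definition fiber p a : seq C := sval (closed_field_poly_normal (p - a%:P)).

Lemma cmod_prod (s : seq C) (f : C -> C) :
  cmod (\prod_(x <- s) f x) = \prod_(x <- s) cmod (f x).
Proof. by apply: (big_morph _ (@normcM R) (@normc1 R)). Qed.

Lemma fiberE p a : (0 < degree p)%N ->
  p - a%:P = lead_coef p *: \prod_(x <- fiber p a) ('X - x%:P).
Proof.
move=> p0; rewrite [LHS](svalP (closed_field_poly_normal (p - a%:P))); congr (_ *: _).
rewrite lead_coefDl// size_polyN (leq_ltn_trans (size_polyC_leq1 _))//.
by rewrite -ltn_predRL.
Qed.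

Lemma size_fiber p a : (0 < degree p)%N -> size (fiber p a) = degree p.
Proof.
move=> p0; have s1 : (1 < size p)%N by rewrite -ltn_predRL.
have lp : lead_coef p != 0 by rewrite lead_coef_eq0 -size_poly_gt0 ltnW.
have := congr1 (size \o polyseq) (fiberE a p0) => /=.
rewrite size_scale// size_prod_XsubC size_polyDl ?size_polyN; first by rewrite /degree => ->.
by rewrite (leq_ltn_trans (size_polyC_leq1 _)).
Qed.

Lemma horner_fiber p a y : (0 < degree p)%N ->
  p.[y] - a = lead_coef p * \prod_(x <- fiber p a) (y - x).
Proof.
move=> p0; have := congr1 (horner^~ y) (fiberE a p0).
rewrite !hornerE horner_prod => ->; congr (_ * _).
by apply: eq_bigr => x _; rewrite !hornerE.
Qed.

Lemma cmod_horner_fiber p a y : (0 < degree p)%N ->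
  cmod (p.[y] - a) = cmod (lead_coef p) * \prod_(x <- fiber p a) cmod (y - x).
Proof. by move=> p0; rewrite horner_fiber// normcM cmod_prod. Qed.

Lemma mem_fiber p a x : (0 < degree p)%N -> x \in fiber p a -> p.[x] = a.
Proof.
move=> p0 xp; apply/eqP; rewrite -subr_eq0 horner_fiber//.
by rewrite (big_rem x)//= subrr mul0r mulr0.
Qed.

Lemma cmod_lead_gt0 p : (0 < degree p)%N -> 0 < cmod (lead_coef p).
Proof.
move=> p0; apply: cmod_gt0; rewrite lead_coef_eq0 -size_poly_gt0.
by rewrite (leq_trans _ (leq_pred _)).
Qed.

Lemma sum_ln_fiber p a y : (0 < degree p)%N -> y \notin fiber p a ->
  \sum_(x <- fiber p a) ln (cmod (y - x)) =
  ln (cmod (p.[y] - a)) - ln (cmod (lead_coef p)).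
Proof.
move=> p0 yp; rewrite cmod_horner_fiber//.
have H s : y \notin s -> 0 < \prod_(x <- s) cmod (y - x) /\
    ln (\prod_(x <- s) cmod (y - x)) = \sum_(x <- s) ln (cmod (y - x)).
  elim: s => [|x s IH]; first by rewrite !big_nil ln1.
  rewrite inE negb_or !big_cons => /andP[yx /IH[h1 h2]].
  have yx0 : 0 < cmod (y - x) by apply: cmod_gt0; rewrite subr_eq0.
  by rewrite mulr_gt0// lnM ?posrE// h2.
have [h1 <-] := H _ yp.
by rewrite lnM ?posrE ?cmod_lead_gt0// addrAC subrr add0r.
Qed.

(** Each factor of the factorisation over the roots satisfies |y - x| <= (1 + |x|) (1 + |y|). *)
Lemma one_add_cmod_horner_le p : (0 < degree p)%N ->
  exists2 K : R, 0 < K & forall y, 1 + cmod p.[y] <= K * (1 + cmod y) ^+ degree p.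
Proof.
move=> p0; pose A := \prod_(x <- fiber p 0) (1 + cmod x).
have A0 : 0 <= A by apply: prodr_ge0 => x _; rewrite addr_ge0// cmod_ge0.
exists (1 + cmod (lead_coef p) * A); first by rewrite ltr_wpDr// mulr_ge0// cmod_ge0.
move=> y; have y1 : 1 <= 1 + cmod y by rewrite lerDl cmod_ge0.
rewrite mulrDl mul1r lerD//; first by rewrite exprn_ege1.
rewrite -[p.[y]]subr0 cmod_horner_fiber// -mulrA ler_wpM2l ?cmod_ge0//.
rewrite -(size_fiber 0 p0) /A; elim: (fiber p 0) => [|x s IH].
  by rewrite !big_nil mulr1.
rewrite !big_cons/= exprS mulrACA ler_pM ?cmod_ge0//.
  by apply: prodr_ge0 => *; exact: cmod_ge0.
have := cmodB_triangle 0 y x; rewrite subr0 sub0r normcN.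
have := cmod_ge0 x; have := cmod_ge0 y; nra.
Qed.

(** Let X be the sum of the moduli of the roots. If |y| >= 2 X + 1, every factor |y - x| is at least
    (1 + |y|) / 2; otherwise 1 + |y| <= 2 X + 2. The constant adds the contributions of the two
    cases. *)
Lemma one_add_cmod_horner_ge p : (0 < degree p)%N ->
  exists2 K : R, 0 < K & forall y, (1 + cmod y) ^+ degree p <= K * (1 + cmod p.[y]).
Proof.
move=> p0; pose X := \sum_(x <- fiber p 0) cmod x.
have X0 : 0 <= X by apply: sumr_ge0 => x _; exact: cmod_ge0.
pose d := degree p; pose l := cmod (lead_coef p).
have l0 : 0 < l by exact: cmod_lead_gt0.
have K1 : 0 < 2 ^+ d / l by rewrite divr_gt0// exprn_gt0.
have K2 : 0 < (2 * X + 2) ^+ d by rewrite exprn_gt0//; lra.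
exists (2 ^+ d / l + (2 * X + 2) ^+ d); first by rewrite addr_gt0.
move=> y; have py0 := cmod_ge0 p.[y]; have y0 := cmod_ge0 y.
case: (lerP (2 * X + 1) (cmod y)) => Xy; last first.
  apply: (@le_trans _ _ ((2 * X + 2) ^+ d)).
    by rewrite lerXn2r ?nnegrE//; lra.
  by move: K1 K2; set u := _ / l; set v := _ ^+ d; nra.
have : l * ((1 + cmod y) / 2) ^+ d <= cmod p.[y].
  rewrite -[p.[y]]subr0 cmod_horner_fiber// ler_wpM2l ?(ltW l0)//.
  have H x : x \in fiber p 0 -> (1 + cmod y) / 2 <= cmod (y - x).
    move=> xf; have : cmod x <= X.
      by rewrite /X (big_rem x)//= lerDl; apply: sumr_ge0 => *; exact: cmod_ge0.
    have := cmodB_triangle x y 0; rewrite !subr0; lra.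
  rewrite /d -(size_fiber 0 p0); elim: (fiber p 0) H => [|x s IH] H.
    by rewrite big_nil.
  rewrite big_cons/= exprS ler_pM//; [by lra|by rewrite exprn_ge0//; lra| |].
    by apply: H; rewrite inE eqxx.
  by apply: IH => x' x's; apply: H; rewrite inE x's orbT.
rewrite expr_div_n mulrDl => H.
apply: (@le_trans _ _ (2 ^+ d / l * cmod p.[y])).
  have := ler_wpM2l (ltW K1) H; congr (_ <= _); field.
  by rewrite (gt_eqF l0) expf_neq0.
by rewrite -[leLHS]addr0 lerD// ?ler_wpM2l ?(ltW K1)//; [lra|apply: mulr_ge0; [exact: ltW|lra]].
Qed.

Definition log_height y : R := ln (1 + cmod y).

Lemma log_height_ge0 y : 0 <= log_height y.
Proof. by rewrite ln_ge0// lerDl cmod_ge0. Qed.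

Lemma continuous_log_height : continuous (log_height : C -> R).
Proof.
apply: (@continuous_cmod_lip _ _ 1) => y y'.
rewrite (le_trans (ln_lipschitz ltr01 _ _)) ?lerDl ?cmod_ge0// divr1 mul1r.
by rewrite opprD addrACA subrr add0r cmod_dist.
Qed.

(** Logarithms of the two growth bounds. Boundedness over the whole plane is what makes the averages
    [green] converge uniformly. *)
Lemma log_height_horner p : (0 < degree p)%N ->
  exists M : R, forall y, `|log_height p.[y] - (degree p)%:R * log_height y| <= M.
Proof.
move=> p0; have [K K0 HK] := one_add_cmod_horner_le p0.
have [K' K'0 HK'] := one_add_cmod_horner_ge p0.
exists (`|ln K| + `|ln K'|) => y.
have h x : 0 < 1 + cmod x :> R by rewrite ltr_pwDl// cmod_ge0.
have e0 : 0 < (1 + cmod y) ^+ degree p by rewrite exprn_gt0.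
have A := HK y; rewrite -ler_ln ?posrE// ?mulr_gt0// lnM ?posrE// lnXn// in A.
have B := HK' y; rewrite -ler_ln ?posrE// ?mulr_gt0// lnM ?posrE// lnXn// in B.
rewrite -[_ *+ _]mulr_natl in A; rewrite -[_ *+ _]mulr_natl in B.
rewrite /log_height; move: A B; set u := (degree p)%:R * _.
have := ler_norm (ln K); have := ler_norm (ln K').
rewrite ler_norml; have := normr_ge0 (ln K); have := normr_ge0 (ln K').
by move=> *; apply/andP; split; lra.
Qed.

(** In degree at least 2, |p(y)| <= |y| would give (1 + |y|)^2 <= K (1 + |y|), impossible for |y| >
    K. In degree 1, expansion at infinity comes from the leading coefficient. *)
Lemma escape p : (0 < degree p)%N ->
  (degree p = 1%N -> 1 < cmod (lead_coef p)) ->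
  exists r : R, forall y, r < cmod y -> cmod y < cmod p.[y].
Proof.
move=> p0 p1; case: (ltnP 1 (degree p)) => d1.
  have [K K0 HK] := one_add_cmod_horner_ge p0.
  exists (Num.max K 1) => y; rewrite gt_max => /andP[Ky y1].
  have := HK y; have : (1 + cmod y) ^+ 2 <= (1 + cmod y) ^+ degree p.
    by rewrite ler_weXn2l// lerDl cmod_ge0.
  move=> h1 h2; have := le_trans h1 h2.
  rewrite leNgt; apply: contraNlt => h.
  by rewrite expr2 (@le_lt_trans _ _ (K * (1 + cmod y)))// ?ler_wpM2l ?lerD2l ?(ltW K0)// ltr_pM2r; lra.
have d1' : degree p = 1%N by apply/eqP; rewrite eqn_leq d1.
have l1 := p1 d1'; have := size_fiber 0 p0; rewrite d1'.
case E : (fiber p 0) => [//|x [|//]] _.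
(* Beyond this radius |l| (|y| - |x|) > |y|, where l is the leading coefficient and x the only
   root. *)
exists (cmod (lead_coef p) * cmod x / (cmod (lead_coef p) - 1)) => y.
rewrite ltr_pdivrMr ?subr_gt0// => H.
rewrite -[p.[y]]subr0 cmod_horner_fiber// E big_seq1.
have := cmodB_triangle x y 0; rewrite !subr0.
have := cmod_ge0 (y - x); nra.
Qed.

Lemma degree_comp p q : degree (p \Po q) = (degree p * degree q)%N.
Proof. exact: size_comp_poly. Qed.

End PolynomialGrowth.

(** * Words as compositions: order, degree, escape *)

Section Words.
Variable R : realType.
Local Notation C := R[i].
Implicit Types (p q h : {poly C}) (w : seq {poly C}).

Lemma word_comp_cons p w : word_comp (p :: w) = word_comp w \Po p.
Proof.
rewrite /word_comp /= comp_polyXr.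
(* The accumulator of the fold is generalised to make the induction go through. *)
suff H h : foldl (fun h g => g \Po h) h w = foldl (fun h g => g \Po h) 'X w \Po h by exact: H.
elim: w h => [|g w IH] h /=; first by rewrite comp_polyX.
by rewrite IH [in RHS]IH comp_polyXr comp_polyA.
Qed.

Lemma degree_word_comp w : degree (word_comp w) = (\prod_(g <- w) degree g)%N.
Proof.
elim: w => [|p w IH]; first by rewrite big_nil /degree size_polyX.
by rewrite word_comp_cons degree_comp IH big_cons mulnC.
Qed.

Lemma word_comp_escape w (r : R) y :
  (forall g, g \in w -> forall y, r < cmod y -> r < cmod g.[y]) ->
  r < cmod y -> r < cmod (word_comp w).[y].
Proof.
elim: w y => [|g w IH] y H ry; first by rewrite hornerX.
rewrite word_comp_cons horner_comp; apply: IH => [g' g'w|].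
  by apply: H; rewrite inE g'w orbT.
by apply: H => //; rewrite inE eqxx.
Qed.

End Words.

Lemma big_tuple_cons (A : nmodType) (T : finType) n (H : n.+1.-tuple T -> A) :
  \sum_(w : n.+1.-tuple T) H w =
  \sum_(g : T) \sum_(w : n.-tuple T) H [tuple of g :: w].
Proof.
rewrite pair_big/= (reindex (fun gw : T * n.-tuple T => [tuple of gw.1 :: gw.2]))//.
exists (fun w => (thead w, [tuple of behead w])) => [[g w] _|w _] /=.
  by congr pair; apply: val_inj.
by rewrite [RHS]tuple_eta.
Qed.

(* The telescoping sequences [u n + K q^n] and [u n - K q^n] are monotone. *)
Lemma geometric_limit (R : realType) (T : Type) (u : nat -> T -> R) (M q : R) :
  0 <= q -> q < 1 -> (forall n y, `|u n.+1 y - u n y| <= M * q ^+ n) ->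
  exists v, forall n y, `|u n y - v y| <= M / (1 - q) * q ^+ n.
Proof.
move=> q0 q1 uM; pose K := M / (1 - q).
pose X n y := u n y + K * q ^+ n; pose Y n y := u n y - K * q ^+ n.
have step n : K * q ^+ n - K * q ^+ n.+1 = M * q ^+ n.
  by rewrite /K exprS; field; rewrite subr_eq0 gt_eqF.
have dX m n y : (m <= n)%N -> X n y <= X m y.
  move/subnKC => <-; elim: (n - m)%N => [|k IH]; first by rewrite addn0.
  rewrite addnS (le_trans _ IH)// /X; have := step (m + k)%N.
  by have := uM (m + k)%N y; rewrite ler_norml => /andP[]; lra.
have iY m n y : (m <= n)%N -> Y m y <= Y n y.
  move/subnKC => <-; elim: (n - m)%N => [|k IH]; first by rewrite addn0.
  rewrite addnS (le_trans IH)// /Y; have := step (m + k)%N.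
  by have := uM (m + k)%N y; rewrite ler_norml => /andP[]; lra.
have YX m n y : Y m y <= X n y.
  rewrite (le_trans (iY _ _ y (leq_maxl m n)))// (le_trans _ (dX _ _ y (leq_maxr m n)))//.
  have : 0 <= M * q ^+ maxn m n by rewrite (le_trans _ (uM _ y)).
  move=> h; have : 0 <= K * q ^+ maxn m n.
    by rewrite /K mulrAC divr_ge0// subr_ge0 ltW.
  by rewrite /X /Y; lra.
exists (fun y => sup (range (Y ^~ y))) => n y.
have hs : has_sup (range (Y ^~ y)).
  by split; [exists (Y 0 y); exists 0|exists (X 0 y) => _ [m _ <-]].
have l1 : Y n y <= sup (range (Y ^~ y)) by apply: ub_le_sup; [case: hs|exists n].
have l2 : sup (range (Y ^~ y)) <= X n y.
  by apply: ge_sup => [|_ [m _ <-]//]; case: hs.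
by rewrite ler_norml; move: l1 l2; rewrite /X /Y -/K; move: (sup _) => *; apply/andP; split; lra.
Qed.

(** * The dynamical Green function *)

Section GreenFunction.
Variables (R : realType) (G : {fset {poly R[i]}}).
Local Notation C := R[i].
Hypothesis G_degree : forall g, g \in G -> (0 < degree g)%N.
Hypothesis G_nonlinear : exists2 g, g \in G & (2 <= degree g)%N.
Local Notation D := (total_degree G).

Definition word n (w : n.-tuple G) : {poly C} := word_comp (map val w).

Lemma word_cons n (g : G) (w : n.-tuple G) :
  word [tuple of g :: w] = word w \Po val g.
Proof. exact: word_comp_cons. Qed.

Lemma degree_word n (w : n.-tuple G) : (0 < degree (word w))%N.
Proof.
rewrite /word degree_word_comp big_map prodn_gt0// => g; exact: G_degree (valP g).
Qed.

Lemma total_degreeE : D = (\sum_(g : G) degree (val g))%N.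
Proof. by rewrite /total_degree big_seq_fsetE. Qed.

Lemma card_lt_total_degree : (#|{: G}| < D)%N.
Proof.
have [h hG h2] := G_nonlinear; rewrite total_degreeE -sum1_card.
rewrite (bigD1 [` hG]%fset)//= [ltnRHS](bigD1 [` hG]%fset)//= -addSn leq_add//.
by apply: leq_sum => g _; exact: G_degree (valP g).
Qed.

Lemma total_degree_gt0 : 0 < D%:R :> R.
Proof. by rewrite ltr0n (leq_ltn_trans _ card_lt_total_degree). Qed.

Definition contraction : R := #|{: G}|%:R / D%:R.

Lemma contraction_ge0 : 0 <= contraction.
Proof. by rewrite divr_ge0. Qed.

Lemma contraction_lt1 : contraction < 1.
Proof. by rewrite ltr_pdivrMr ?total_degree_gt0// mul1r ltr_nat card_lt_total_degree. Qed.

(** The normalisation [D ^ n] counts preimages rather than words, so the total weight is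
    [contraction ^+ n] and not 1. *)
Definition word_average n (H : n.-tuple G -> R) : R := (D ^ n)%:R^-1 * \sum_w H w.

Lemma word_average_le n (H : n.-tuple G -> R) (B : R) :
  (forall w, `|H w| <= B) -> `|word_average H| <= B * contraction ^+ n.
Proof.
move=> HB; rewrite normrM ger0_norm ?invr_ge0// mulrC ler_pdivrMr; last first.
  by rewrite natrX exprn_gt0// total_degree_gt0.
rewrite -mulrA natrX -exprMn divfK ?gt_eqF ?total_degree_gt0//.
rewrite (le_trans (ler_norm_sum _ _ _))// (le_trans (ler_sum _ (fun w _ => HB w)))//.
by rewrite sumr_const card_tuple -natrX mulr_natr.
Qed.

Definition green n (y : C) : R := word_average (fun w : n.-tuple G => log_height (word w).[y]).

Lemma green0 y : green 0 y = log_height y.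
Proof.
rewrite /green /word_average expn0 invr1 mul1r (big_pred1 [tuple])/=.
  by rewrite /word /word_comp/= hornerX.
by case=> -[|//] sw; apply/esym/eqP/val_inj.
Qed.

(** The first letter of a word is applied first, so splitting it off evaluates [green n] at the
    image points. *)
Lemma greenS n y : green n.+1 y = D%:R^-1 * \sum_(g : G) green n (val g).[y].
Proof.
rewrite /green /word_average -mulr_sumr mulrA -invfM -natrM -expnS big_tuple_cons.
by congr (_ * _); apply: eq_bigr => g _; apply: eq_bigr => w _; rewrite word_cons horner_comp.
Qed.

(** For n = 0 this is [log_height_horner] averaged over the generators. Each application of [greenS]
    sums N such differences and divides by D, which gains one factor N / D. *)
Lemma green_step : exists M, forall n y, `|green n.+1 y - green n y| <= M * contraction ^+ n.
Proof.
have D0 := total_degree_gt0.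
have HM (g : G) := log_height_horner (G_degree (valP g)).
pose M (g : G) := sval (cid (HM g)).
have MP (g : G) y : `|log_height (val g).[y] - (degree (val g))%:R * log_height y| <= M g.
  by move: y; exact: svalP (cid (HM g)).
exists (D%:R^-1 * \sum_(g : G) M g); elim=> [|n IH] y.
  rewrite greenS green0 expr0 mulr1.
  (* The degrees of the generators add up to [D]. *)
  have {1}-> : log_height y = D%:R^-1 * \sum_(g : G) (degree (val g))%:R * log_height y.
    by rewrite -mulr_suml -natr_sum -total_degreeE mulrA mulVf ?mul1r// gt_eqF.
  rewrite -mulrBr -sumrB normrM ger0_norm ?invr_ge0 ?(ltW D0)//.
  rewrite ler_pM2l ?invr_gt0// (le_trans (ler_norm_sum _ _ _))// ler_sum// => g _.
  by rewrite green0.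
rewrite !(greenS _ y) -mulrBr -sumrB normrM ger0_norm ?invr_ge0 ?(ltW D0)//.
rewrite (le_trans (ler_wpM2l _ (ler_norm_sum _ _ _))) ?invr_ge0 ?(ltW D0)//.
rewrite (le_trans (ler_wpM2l _ (ler_sum _ (fun g _ => IH (val g).[y])))) ?invr_ge0 ?(ltW D0)//.
rewrite sumr_const /contraction exprS -mulr_natr le_eqVlt; apply/orP; left; apply/eqP.
by ring.
Qed.

Lemma continuous_green n : continuous (green n).
Proof.
move=> y; have FF : ProperFilter (nbhs y) by exact: nbhs_pfilter.
apply: cvgM; first exact: cvg_cst.
apply: cvg_big => [|w _]; first exact: add_continuous.
have H : {for y, continuous ((@log_height R : C -> R) \o (horner (word w) : C -> C))}.
  by apply: continuous_comp; [exact: continuous_horner|exact: continuous_log_height].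
exact: H.
Qed.

(** The convergence is uniform on the whole plane, so continuity passes to the limit by an e / 3
    argument. *)
Lemma green_limit : exists V : C -> R, continuous V /\
  exists2 K, 0 <= K & forall n y, `|green n y - V y| <= K * contraction ^+ n.
Proof.
have [M HM] := green_step.
have [V HV] := geometric_limit contraction_ge0 contraction_lt1 HM.
exists V; split; last first.
  exists (M / (1 - contraction)) => //.
  by rewrite -[leRHS]mulr1 -(expr0 contraction) (le_trans _ (HV 0%N 0)).
set K := M / _ in HV; have K0 : 0 <= K.
  by rewrite -[leRHS]mulr1 -(expr0 contraction) (le_trans _ (HV 0%N 0)).
move=> y; apply/continuous_cmodP => e e0.
have [n Hn] : exists n, K * contraction ^+ n < e / 3.
  have : K * contraction ^+ n @[n --> \oo] --> K * 0.
    by apply: cvgMr; apply: cvg_expr; rewrite ger0_norm ?contraction_ge0// contraction_lt1.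
  rewrite mulr0 => /cvgrPdist_lt /(_ (e / 3)) []; first by rewrite divr_gt0.
  move=> n _ /(_ n (leqnn _)); rewrite sub0r normrN => /(le_lt_trans (ler_norm _)) H.
  by exists n.
have /continuous_cmodP/(_ (e / 3)) [|d d0 Hd] := @continuous_green n y.
  by rewrite divr_gt0.
exists d => // y' /Hd; have := HV n y; have := HV n y'; move: Hn.
set k := K * _; move: (green n y) (green n y') (V y) (V y') => a b c f.
rewrite !ler_norml !ltr_norml => ? /andP[? ?] /andP[? ?] /andP[? ?]; apply/andP; split; lra.
Qed.

End GreenFunction.

(** * Test functions on the sphere *)

Section SphereFunctions.
Variable R : realType.
Local Notation C := R[i].

Definition extend0 (f : C -> R) (x : sphere R) : R := if x is Some t then f t else 0.

Lemma closed_disc (r : R) : closed [set z : C | cmod z <= r].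
Proof.
rewrite (_ : [set z | _] = (@cmod R : C -> R) @^-1` [set x | x <= r])//.
by apply: closed_comp => [z _|]; [exact: continuous_cmod|exact: closed_le].
Qed.

Lemma continuous_extend0 (f : C -> R) (r : R) : continuous f ->
  (forall t, r <= cmod t -> f t = 0) -> continuous (extend0 f).
Proof.
move=> cf f0 [t|] A; first exact: cf.
(* The complement of the disc, together with infinity, is a neighbourhood of infinity on which the
   extension is 0. *)
move=> /nbhs_singleton A0; exists [set z : C | cmod z <= r].
  by split; [exact: compact_disc|exact: closed_disc].
move=> x [[t /= /negP rt <-]|->//].
by rewrite /= f0// ltW// ltNge.
Qed.

(** A plateau function of the modulus: 1 up to [r], then decreasing linearly to 0 at r + 1. *)
Definition cutoff (r : R) (t : C) : R := Num.max 0 (Num.min 1 (r + 1 - cmod t)).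

Lemma continuous_cutoff r : continuous (cutoff r).
Proof.
apply: (@continuous_cmod_lip _ _ 1) => z w; rewrite mul1r.
rewrite (le_trans _ (cmod_dist _ _))// /cutoff.
move: (cmod z) (cmod w) => a b.
rewrite !(maxEle, minEle); do !case: ifPn; rewrite -?ltNge => *;
 rewrite ler_norml; apply/andP; split; have := ler_norm (a - b); have := ler_norm (b - a); rewrite (distrC b) => *; lra.
Qed.

Lemma cutoff_eq1 r t : cmod t <= r -> cutoff r t = 1.
Proof.
move=> tr; rewrite /cutoff (min_idPl _) ?(max_idPr _)//; lra.
Qed.

Lemma cutoff_eq0 r t : r + 1 <= cmod t -> cutoff r t = 0.
Proof.
by move=> tr; rewrite /cutoff (max_idPl _)// ge_min; apply/orP; right; lra.
Qed.

Lemma cutoff_le1 r t : cutoff r t <= 1.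
Proof. by rewrite /cutoff ge_max ler01 ge_min lexx. Qed.

Lemma integrable_sphere (mu : probability (borel (sphere R)) R) (f : sphere R -> R) :
  continuous f -> mu.-integrable setT (fun x => (f x)%:E).
Proof.
move=> cf.
have /compact_bounded [M [_ HM]] : compact (f @` setT).
  apply: continuous_compact; first exact: continuous_subspaceT.
  exact: one_point_compactification_compact.
apply: measurable_bounded_integrable => //.
- by apply: le_lt_trans (probability_le1 mu measurableT) _; rewrite ltry.
- exact: borel_measurable_fun.
exists M; split; first exact: num_real.
by move=> x Mx y _; apply: HM Mx _ _; exists y.
Qed.

End SphereFunctions.

(** * Integrals against the finite preimage measures *)

Section IterateIntegral.
Variables (R : realType) (G : {fset {poly R[i]}}).
Local Notation C := R[i].
Local Open Scope ereal_scope.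

Lemma integral_ds_iterate_ge0 n a (f : sphere R -> R) :
  measurable_fun setT (f : borel (sphere R) -> R) -> (forall x, 0 <= f x)%R ->
  \int[ds_iterate G n a]_x (f x)%:E =
  (word_average (fun w : n.-tuple G => \sum_(x <- preimages (word w) a) f x)%R)%:E.
Proof.
move=> mf f0.
have c0 : (0 <= (total_degree G ^ n)%:R^-1 :> R)%R by rewrite invr_ge0 ler0n.
(* [s] concatenates the preimages under all words, so the iterate is a multiple of a finite sum of
   Dirac masses. *)
pose s := flatten [seq (preimages (word w) a : seq (borel (sphere R)))
                 | w : n.-tuple G <- index_enum (n.-tuple G : finType)].
pose m := mscale (NngNum c0) (msum (fun i => \d_(nth (None : borel (sphere R)) s i)) (size s)).
transitivity (\int[m]_x (f x)%:E).
  apply: eq_measure_integral => A mA _.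
  rewrite /m /mscale /msum/= /ds_iterate; congr (_ * _).
  transitivity (\sum_(x <- s) (\d_x A : \bar R)).
    by rewrite big_flatten big_map.
  by rewrite (big_nth (None : borel (sphere R))) big_mkord.
have mf' : measurable_fun setT (fun x : borel (sphere R) => (f x)%:E) by exact/measurable_EFinP.
rewrite ge0_integral_mscale//; last by move=> x _; rewrite lee_fin.
rewrite ge0_integral_measure_sum//; last by move=> x _; rewrite lee_fin.
rewrite EFinM; congr (_ * _).
under eq_bigr do rewrite integral_dirac// diracT mul1e.
rewrite sumEFin; congr EFin.
transitivity (\sum_(x <- s) f x)%R.
  by rewrite (big_nth (None : borel (sphere R))) big_mkord.
by rewrite big_flatten big_map.
Qed.

Lemma integral_ds_iterate n a (f : sphere R -> R) : continuous f ->
  \int[ds_iterate G n a]_x (f x)%:E =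
  (word_average (fun w : n.-tuple G => \sum_(x <- preimages (word w) a) f x)%R)%:E.
Proof.
(* The positive and negative parts are integrated separately by the nonnegative case. *)
move=> cf; rewrite integralE.
have mf : measurable_fun setT (f : borel (sphere R) -> R) by exact: borel_measurable_fun.
rewrite (eq_integral (fun x : borel (sphere R) => (Num.max (f x) 0)%:E)); last first.
  by move=> x _; rewrite funeposE EFin_max.
rewrite [X in _ - X](eq_integral (fun x : borel (sphere R) => (Num.max (- f x) 0)%:E)); last first.
  by move=> x _; rewrite funenegE EFin_max.
rewrite !integral_ds_iterate_ge0//; last 4 first.
- by apply: measurable_maxr => //; exact: measurableT_comp.
- by move=> x; rewrite le_max lexx orbT.
- by apply: measurable_maxr.
- by move=> x; rewrite le_max lexx orbT.
rewrite -EFinB /word_average -mulrBr -sumrB; congr (_ * _)%:E.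
apply: eq_bigr => w _; rewrite -sumrB; apply: eq_bigr => x _.
by case: (lerP (f x) 0); case: (lerP (- f x) 0); lra.
Qed.

End IterateIntegral.

(** * Root sums along a segment *)

Section SegmentRoots.
Variable R : realType.
Local Notation C := R[i].
Local Notation leb := (@lebesgue_measure R).
Local Notation I01 := (`[0%R, 1%R]%classic : set R).
Implicit Types (p : {poly C}) (z a : C) (r : R).

Lemma nneseries_term_cvg0 (f : nat -> \bar R) : (forall n, 0 <= f n)%E ->
  (\sum_(k <oo) f k < +oo)%E -> f @ \oo --> 0%E.
Proof.
move=> f0 foo; have := nneseries_tail_cvg foo (fun k _ => f0 k).
apply: (@squeeze_cvge _ _ _ _ (cst 0%E)); last exact: cvg_cst.
apply: nearW => n; rewrite f0/=.
apply: le_trans (nneseries_lim_ge n.+1 _) => //.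
by rewrite big_nat1.
Qed.

Lemma segment_finite z r (s : seq C) : 0 < r ->
  finite_set [set x | segment z r x \in s].
Proof.
move=> r0; elim: s => [|c s IH].
  by rewrite (_ : [set x | _] = set0)//; apply/seteqP; split.
rewrite (_ : [set x | _] = [set x | segment z r x = c] `|` [set x | segment z r x \in s]); last first.
  apply/seteqP; split => x /=; rewrite inE.
    by move=> /orP[/eqP|]; [left|right].
  by move=> [->|->]; rewrite ?eqxx ?orbT.
rewrite finite_setU; split => //.
apply: (@sub_finite_set _ _ [set (complex.Re (c - z)) / r]); last exact: finite_set1.
move=> x /= <-; rewrite /segment {IH}.
by case: z => u v /=; field; rewrite gt_eqF.
Qed.

Lemma Rintegral_unit_sum (I : Type) (s : seq I) (f : I -> R -> R) :
  (forall i, leb.-integrable I01 (fun x => (f i x)%:E)) ->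
  leb.-integrable I01 (fun x => (\sum_(i <- s) f i x)%:E) /\
  \int[leb]_(x in I01) \sum_(i <- s) f i x = \sum_(i <- s) \int[leb]_(x in I01) f i x.
Proof.
move=> intf; elim: s => [|i s [IH1 IH2]].
  rewrite big_nil; split.
    by apply: eq_integrable (integrable_unit_cst 0) => // x _; rewrite big_nil.
  by under eq_Rintegral do rewrite big_nil; rewrite Rintegral_unit_cst.
have inti := intf i; rewrite big_cons -IH2 -RintegralD//; split.
  by apply: eq_integrable (integrableD _ inti IH1) => // x _; rewrite big_cons EFinD.
by apply: eq_Rintegral => x _; rewrite big_cons.
Qed.

(** Integrates the logarithm of the factorisation of p - a. The pointwise identity may fail where
    the segment meets the fiber, because [ln 0 = 0], but this happens only for finitely many
    parameters. *)
Lemma integrable_segment_ln_horner p a z r : (0 < degree p)%N -> 0 < r ->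
  leb.-integrable I01 (fun x => (ln (cmod (p.[segment z r x] - a)))%:E) /\
  \sum_(x <- fiber p a) segment_log z r x =
  \int[leb]_(x in I01) ln (cmod (p.[segment z r x] - a)) - ln (cmod (lead_coef p)).
Proof.
move=> p0 r0; pose S x := \sum_(t <- fiber p a) ln (cmod (segment z r x - t)).
have [H1 H2] := Rintegral_unit_sum (fiber p a) (fun t => integrable_segment_log z t r0).
rewrite -H2.
have mh : measurable_fun I01 (fun x => ln (cmod (p.[segment z r x] - a))).
  apply: (measurableT_comp (@measurable_ln R)).
  apply: (@measurable_segment _ (fun w => cmod (p.[w] - a))) => w.
  have K : {for w, continuous ((fun u : C => cmod (u - a)) \o (horner p : C -> C))}.
    by apply: continuous_comp; [exact: continuous_horner|exact: continuous_cmod_sub].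
  exact: K.
have N0 : leb [set x | segment z r x \in fiber p a] = 0%E.
  by apply: countable_lebesgue_measure0; exact/finite_set_countable/segment_finite.
have mN : measurable ([set x | segment z r x \in fiber p a] : set R).
  apply: countable_measurable => [t|]; first exact: measurable_set1.
  exact/finite_set_countable/segment_finite.
have SE x : ~ segment z r x \in fiber p a ->
    S x + ln (cmod (lead_coef p)) = ln (cmod (p.[segment z r x] - a)).
  by move=> /negP xf; rewrite /S sum_ln_fiber// subrK.
have I1 : leb.-integrable I01 (fun x => (S x + ln (cmod (lead_coef p)))%:E).
  by apply: eq_integrable (integrableD _ H1 (integrable_unit_cst (ln (cmod (lead_coef p))))) => // x _.
have mI1 := measurable_int _ I1.
have mh' := mh; move/measurable_EFinP in mh'.
have I2 : leb.-integrable I01 (fun x => (ln (cmod (p.[segment z r x] - a)))%:E).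
  apply/integrableP; split => //; move/integrableP : I1 => [_].
  congr (_ < _)%E; apply: ae_eq_integral => //; try exact: measurableT_comp.
  exists [set x | segment z r x \in fiber p a]; split => // x /= nx.
  by apply: contrapT => xf; apply: nx => _; rewrite SE.
split => //.
have <- : \int[leb]_(x in I01) (S x + ln (cmod (lead_coef p))) =
    \int[leb]_(x in I01) ln (cmod (p.[segment z r x] - a)).
  rewrite /Rintegral; congr fine; apply: ae_eq_integral => //.
  exists [set x | segment z r x \in fiber p a]; split => // x /= nx.
  by apply: contrapT => xf; apply: nx => _; rewrite SE.
rewrite RintegralD//; last exact: integrable_unit_cst.
by rewrite Rintegral_unit_cst addrK.
Qed.

(** As 0 <= a <= 1, one has 1 + |y| <= |y - a| + 2. If |y - a| >= 1 this is at most 3 |y - a|;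
    otherwise 1 + |y| <= 3, and [ell] absorbs the term - ln |y - a|. *)
Lemma log_height_sub_ln_le (y : C) (a : R) : I01 a ->
  ((`|log_height y - ln (cmod (y - a%:C%C))|)%:E <=
   (ln 3)%:E + ell (a - complex.Re y)%R)%E.
Proof.
rewrite /= in_itv/= => /andP[a0 a1]; have ca : cmod (a%:C%C : C) = a by rewrite cmod_real ger0_norm.
have ln3 : 0 <= ln 3 :> R by rewrite ln_ge0// ler1n.
have y0 := cmod_ge0 y; have h0 := log_height_ge0 y.
case: (eqVneq y a%:C%C) => [->|yNa].
  rewrite subrr cmod0 ln0// subr0 ger0_norm ?log_height_ge0//.
  apply: (@le_trans _ _ (ln 3)%:E); last by rewrite leeDl// ell_ge0.
  by rewrite lee_fin /log_height ca ler_ln ?posrE//; lra.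
have u0 : 0 < cmod (y - a%:C%C) by apply: cmod_gt0; rewrite subr_eq0.
have U1 : cmod (y - a%:C%C) <= 1 + cmod y.
  by have := cmodB_triangle 0 y a%:C%C; rewrite subr0 sub0r normcN ca; lra.
have U2 : cmod y <= cmod (y - a%:C%C) + 1.
  by have := cmodB_triangle a%:C%C y 0; rewrite !subr0 ca; lra.
have l1 : ln (cmod (y - a%:C%C)) <= log_height y by rewrite /log_height ler_ln ?posrE//; lra.
rewrite ger0_norm ?subr_ge0//.
have e1 : ((- ln (cmod (y - a%:C%C)))%:E <= ell (a - complex.Re y)%R)%E.
  apply: le_trans (ln_le_ell (cmod_ge0 _)) (le_ell _).
  rewrite [leRHS]ger0_norm ?cmod_ge0// distrC (le_trans _ (Re_le_cmod _))//.
  by case: (y).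
case: (lerP 1 (cmod (y - a%:C%C))) => [u1|/ltW u1].
  apply: (@le_trans _ _ (ln 3)%:E); last by rewrite leeDl// ell_ge0.
  rewrite lee_fin lerBlDr -lnM ?posrE// /log_height ler_ln ?posrE//; lra.
rewrite EFinB leeD//.
by rewrite lee_fin /log_height ler_ln ?posrE//; lra.
Qed.

(* Dominates, after integration along the segment, the logarithmic singularity of [ln |p - a|]. *)
Definition fiber_error p z r (a : R) : \bar R :=
  (\int[leb]_(x in I01) ell (a - complex.Re p.[segment z r x])%R)%E.

Lemma fiber_error_ge0 p z r (a : R) : (0 <= fiber_error p z r a)%E.
Proof. by apply: integral_ge0 => x _; exact: ell_ge0. Qed.

Lemma continuous_Re_horner p : continuous (fun w : C => complex.Re p.[w]).
Proof.
move=> w; have K : {for w, continuous ((@complex.Re R : C -> R) \o (horner p : C -> C))}.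
  by apply: continuous_comp; [exact: continuous_horner|exact: continuous_Re].
exact: K.
Qed.

Lemma continuous_log_height_horner p : continuous (fun w : C => log_height p.[w]).
Proof.
move=> w; have K : {for w, continuous ((@log_height R : C -> R) \o (horner p : C -> C))}.
  by apply: continuous_comp; [exact: continuous_horner|exact: continuous_log_height].
exact: K.
Qed.

Lemma fiber_error_bound p z r (a : R) : (0 < degree p)%N -> 0 < r -> I01 a ->
  (fiber_error p z r a < +oo)%E ->
  `|\int[leb]_(x in I01) log_height p.[segment z r x] -
    \int[leb]_(x in I01) ln (cmod (p.[segment z r x] - a%:C%C))| <=
  ln 3 + fine (fiber_error p z r a).
Proof.
move=> p0 r0 a01 Eoo.
have cV := @continuous_log_height_horner p.
have I1 := @integrable_segment _ (fun w => log_height p.[w]) z r cV.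
have [I2 _] := integrable_segment_ln_horner a%:C%C z p0 r0.
rewrite -RintegralB//.
have I3 := integrableB _ I1 I2.
rewrite -lee_fin EFin_normr_Rintegral//; last exact: I3.
apply: le_trans (le_abse_integral _ _ _) _ => //.
  by apply: measurable_int (I3 _).
rewrite EFinD fineK ?ge0_fin_numE ?fiber_error_ge0//.
have mell : measurable_fun I01 (fun x => ell (a - complex.Re p.[segment z r x])).
  apply: (measurableT_comp (@measurable_ell R)); apply: measurable_funB => //.
  exact: (@measurable_segment _ (fun w => complex.Re p.[w]) _ _ _ (@continuous_Re_horner p)).
apply: (@le_trans _ _ (\int[leb]_(x in I01) ((ln 3)%:E + ell (a - complex.Re p.[segment z r x])%R))%E).
  apply: ge0_le_integral => //.
  - by apply: measurableT_comp => //; apply: measurable_int (I3 _).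
  - by apply: emeasurable_funD.
  - by move=> x _; exact: log_height_sub_ln_le.
rewrite ge0_integralD//; last 2 first.
- by move=> x _; rewrite lee_fin ln_ge0// ler1n.
- by move=> x _; exact: ell_ge0.
rewrite integral_cst//= [X in ((ln 3)%:E * X)%E](_ : _ = 1%E); last exact: unit_segment_measure.
by rewrite mule1.
Qed.

(** The indicator turns the integral over [0, 1] in the second variable into one over the line,
    ready for Tonelli on the product. *)
Let kernel p z r (ax : R * R) : \bar R :=
  (ell (ax.1 - complex.Re p.[segment z r ax.2])%R * (\1_I01 ax.2)%:E)%E.

Let kernel_ge0 p z r ax : (0 <= kernel p z r ax)%E.
Proof. by rewrite mule_ge0 ?ell_ge0. Qed.

Let measurable_kernel p z r : measurable_fun setT (kernel p z r).
Proof.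
apply: emeasurable_funM.
  apply: (measurableT_comp (@measurable_ell R)); apply: measurable_funB => //.
  apply: (@measurableT_comp _ _ _ _ _ _ (fun x => complex.Re p.[segment z r x]) _ snd) => //.
  exact: (@measurable_segment _ (fun w => complex.Re p.[w]) _ _ _ (@continuous_Re_horner p)).
by apply/measurable_EFinP; apply: (@measurableT_comp _ _ _ _ _ _ (\1_I01 : R -> R) _ snd).
Qed.

Let fiber_errorE p z r (a : R) : fiber_error p z r a = (\int[leb]_x kernel p z r (a, x))%E.
Proof.
rewrite /fiber_error integral_mkcond; apply: eq_integral => x _.
by rewrite patchE /kernel/= indicE; case: ifPn => _; rewrite ?mule1 ?mule0.
Qed.

Lemma measurable_fiber_error p z r : measurable_fun [set: R] (fiber_error p z r).
Proof.
rewrite (_ : fiber_error _ _ _ = fun a : R => (\int[leb]_x kernel p z r (a, x))%E); last first.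
  by apply/funext => a; exact: fiber_errorE.
by apply: (@measurable_fun_fubini_tonelli_F _ _ _ _ _ leb (kernel p z r)) => //; exact: measurable_kernel.
Qed.

(** For a fixed point of the segment, the integrand as a function of [a] is a translate of [ell], of
    integral at most 4. Exchanging the integrals gives a bound that depends neither on the
    polynomial nor on its degree. *)
Lemma integral_fiber_error p z r : (\int[leb]_(a in I01) fiber_error p z r a <= 4%:E)%E.
Proof.
apply: (@le_trans _ _ (\int[leb]_a fiber_error p z r a)%E).
  apply: ge0_subset_integral => //; first exact: measurable_fiber_error.
  by move=> a _; exact: fiber_error_ge0.
under eq_integral do rewrite fiber_errorE.
rewrite (@fubini_tonelli _ _ _ _ _ leb leb (kernel p z r))//; last exact: measurable_kernel.
apply: (@le_trans _ _ (\int[leb]_x (4%:E * (\1_I01 x)%:E))%E).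
  apply: ge0_le_integral => //.
  - by move=> x _; apply: integral_ge0.
  - by apply: (@measurable_fun_fubini_tonelli_G _ _ _ _ _ leb (kernel p z r)) => //; exact: measurable_kernel.
  - by apply: emeasurable_funM => //; exact/measurable_EFinP/measurable_indic.
  move=> x _; rewrite /kernel/=.
  rewrite ge0_integralZr//; last 2 first.
  - by apply: (measurableT_comp (@measurable_ell R)); apply: measurable_funB.
  - by move=> a _; exact: ell_ge0.
  rewrite lee_wpmul2r//.
  set b := complex.Re _.
  have E : (fun u : R => ell ((u - b) / 1)) = (fun u => ell (u - b)).
    by apply/funext => u; rewrite divr1.
  by have := integral_ell b measurableT ltr01; rewrite mulr1 E.
rewrite ge0_integralZl//; last by apply/measurable_EFinP/measurable_indic.
rewrite integral_indic// setIT [X in (_ * X)%E](_ : _ = 1%E); last exact: unit_segment_measure.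
by rewrite mule1.
Qed.

End SegmentRoots.

(** * Passage to the weak limit of the preimage measures *)

Section WeakLimit.
Variables (R : realType) (G : {fset {poly R[i]}}).
Local Notation C := R[i].
Local Notation leb := (@lebesgue_measure R).
Local Notation I01 := (`[0%R, 1%R]%classic : set R).
Local Notation D := (total_degree G).
Local Notation q := (contraction G).
Hypothesis G_degree : forall g, g \in G -> (0 < degree g)%N.
Hypothesis G_nonlinear : exists2 g, g \in G & (2 <= degree g)%N.

Lemma escape_radius :
  (forall g, g \in G -> degree g = 1%N -> 1 < cmod (lead_coef g)) ->
  exists2 r : R, 1 <= r & forall g, g \in G -> forall y, r < cmod y -> r < cmod g.[y].
Proof.
move=> G1.
(* The stronger inequality |y| < |g(y)| survives enlarging the radius, so maxima can be taken along
   the list of generators. *)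
suff H (s : seq {poly C}) : {subset s <= G} ->
    exists2 r : R, 1 <= r & forall g, g \in s -> forall y, r < cmod y -> cmod y < cmod g.[y].
  have [r r1 Hr] := H _ (fun g => id); exists r => // g gG y ry.
  exact: lt_trans (Hr _ gG _ ry).
elim: s => [|g s IH] sG; first by exists 1.
have /IH[r r1 Hr] : {subset s <= G} by move=> h hs; apply: sG; rewrite inE hs orbT.
have gG : g \in G by apply: sG; rewrite inE eqxx.
have [r' Hr'] := escape (G_degree gG) (G1 _ gG).
exists (Num.max r r'); first by rewrite le_max r1.
move=> h; rewrite inE => /predU1P[->|hs] y; rewrite gt_max => /andP[ry r'y]; first exact: Hr'.
exact: Hr.
Qed.

Variable r0 : R.
Hypothesis r0_ge1 : 1 <= r0.
Hypothesis r0_escape : forall g, g \in G -> forall y, r0 < cmod y -> r0 < cmod g.[y].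

(** A point outside the escape disc stays outside along the word, so it cannot reach [a]. All fibers
    over the disc thus lie in the same disc. *)
Lemma fiber_word_bounded n (w : n.-tuple G) a x :
  cmod a <= r0 -> x \in fiber (word w) a -> cmod x <= r0.
Proof.
move=> ar xf; rewrite leNgt; apply/negP => xr; move: ar; apply/negP; rewrite -ltNge.
rewrite -(mem_fiber (degree_word G_degree w) xf); apply: word_comp_escape => // g.
by move=> /mapP[h _ ->]; exact: r0_escape (valP h).
Qed.

Variable mu : probability (borel (sphere R)) R.

Definition weak_limit (a : sphere R) :=
  forall f : sphere R -> R, continuous f ->
    (\int[ds_iterate G n a]_x (f x)%:E)%E @[n --> \oo] --> (\int[mu]_x (f x)%:E)%E.

Lemma integral_ds_fiber n (a : C) (f : sphere R -> R) : continuous f ->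
  (\int[ds_iterate G n (Some a)]_x (f x)%:E)%E =
  (word_average (fun w : n.-tuple G => \sum_(x <- fiber (word w) a) f (Some x)))%:E.
Proof.
by move=> cf; rewrite integral_ds_iterate//; congr (_ * _)%:E; apply: eq_bigr => w _; rewrite big_map.
Qed.

(** The set consists of infinity and the points of modulus at least r0 + 1. The continuous function
    1 - cutoff equals 1 there and vanishes on every fiber of [a], so its integral against the limit
    is 0. *)
Lemma weak_limit_tight (a : C) : cmod a <= r0 -> weak_limit (Some a) ->
  mu [set x : borel (sphere R) | extend0 (cutoff (R := R) r0) x = 0] = 0%E.
Proof.
move=> ar0 wl; pose f (x : sphere R) : R := 1 - extend0 (cutoff r0) x.
have ce : continuous (extend0 (cutoff (R := R) r0)).
  apply: (@continuous_extend0 _ _ (r0 + 1)); first exact: continuous_cutoff.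
  exact: cutoff_eq0.
have cf : continuous f.
  move=> x; have FF : ProperFilter (nbhs x) by exact: nbhs_pfilter.
  by apply: cvgB; [exact: cvg_cst|exact: ce].
have f0 x : 0 <= f x.
  by rewrite subr_ge0; case: x => [t|] /=; rewrite ?cutoff_le1.
have int0 : (\int[mu]_x (f x)%:E = 0)%E.
  have := wl f cf; rewrite (_ : (fun n => _) = cst 0%E).
    by move=> /(cvg_unique _ (cvg_cst 0%E)) <-.
  apply/funext => n; rewrite integral_ds_fiber// /word_average big1 ?mulr0// => w _.
  rewrite big_seq big1// => x xf.
  by rewrite /f /= cutoff_eq1 ?subrr// (fiber_word_bounded _ xf).
have mf : measurable_fun setT (f : borel (sphere R) -> R) by exact: borel_measurable_fun.
have mA : measurable ([set x : borel (sphere R) | extend0 (cutoff (R := R) r0) x = 0]).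
  rewrite [X in measurable X](_ : _ = f @^-1` [set 1]); last first.
    by apply/seteqP; split => x /=; rewrite /f; lra.
  by rewrite -[X in measurable X]setTI; exact: mf.
apply/eqP; rewrite eq_le measure_ge0 andbT -int0.
rewrite -[X in mu X]setIT -integral_indic//; apply: ge0_le_integral => //.
- by apply/measurable_EFinP; exact: measurable_indic.
- exact/measurable_EFinP.
- move=> x _; rewrite lee_fin indicE.
  have [h|h] := pselect (extend0 (cutoff (R := R) r0) x = 0).
    by rewrite mem_set//= /f h subr0.
  by rewrite memNset//= f0.
Qed.

(** Cutting off at r0 + 1 rather than [r0] leaves [segment_log] unchanged on the disc of radius r0 +
    1, which carries the limit measure. *)
Definition segment_test z r : sphere R -> R :=
  extend0 (fun t => segment_log z r t * cutoff (r0 + 1) t).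

Lemma continuous_segment_test z r : 0 < r -> continuous (segment_test z r).
Proof.
move=> rp; apply: (@continuous_extend0 _ _ (r0 + 1 + 1)).
  move=> t; have FF : ProperFilter (nbhs t) by exact: nbhs_pfilter.
  by apply: cvgM; [exact: continuous_segment_log|exact: continuous_cutoff].
by move=> t tr; rewrite cutoff_eq0// mulr0.
Qed.

(** Its limit is the additive constant in the final formula for the potential. *)
Definition leading n : R := word_average (fun w : n.-tuple G => ln (cmod (lead_coef (word w)))).

Let B z r n (a : R) : \bar R :=
  ((D ^ n)%:R^-1%:E * (\sum_(w : n.-tuple G) fiber_error (word w) z r a)%E)%E.

Let B_ge0 z r n a : (0 <= B z r n a)%E.
Proof. by rewrite mule_ge0 ?lee_fin ?invr_ge0//; apply: sume_ge0 => w _; exact: fiber_error_ge0. Qed.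

Let measurable_B z r n : measurable_fun I01 (B z r n).
Proof.
apply: emeasurable_funM => //; apply: emeasurable_sum => w.
by apply: measurable_funTS; exact: measurable_fiber_error.
Qed.

Let integral_B z r n : (\int[leb]_(a in I01) B z r n a <= (4 * q ^+ n)%:E)%E.
Proof.
rewrite ge0_integralZl//; last 2 first.
- by apply: emeasurable_sum => w; apply: measurable_funTS; exact: measurable_fiber_error.
- by move=> a _; apply: sume_ge0 => w _; exact: fiber_error_ge0.
rewrite ge0_integral_sum//; last 2 first.
- by move=> w; apply: measurable_funTS; exact: measurable_fiber_error.
- by move=> w a _; exact: fiber_error_ge0.
apply: (@le_trans _ _ ((D ^ n)%:R^-1%:E * (\sum_(w : n.-tuple G) 4%:E)%E)%E).
  rewrite lee_wpmul2l ?lee_fin ?invr_ge0//; apply: lee_sum => w _.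
  exact: integral_fiber_error.
rewrite sumEFin -EFinM lee_fin.
rewrite (le_trans (ler_norm _))//.
by apply: (@word_average_le _ _ G_degree G_nonlinear n (fun=> 4)) => w; rewrite ger0_norm.
Qed.

(** The level-n error [B] has integral at most 4 q^n over [0, 1], so the series over n is
    integrable. At a point off the polar set where this series is finite, its terms tend to 0; a
    single [a] serves all levels. *)
Lemma good_fiber z r (E : set (sphere R)) : polar E ->
  exists a : R, [/\ I01 a, ~ E (Some a%:C%C),
    forall n (w : n.-tuple G), (fiber_error (word w) z r a < +oo)%E &
    word_average (fun w : n.-tuple G => fine (fiber_error (word w) z r a)) @[n --> \oo] --> 0].
Proof.
move=> pE; pose F a := (\sum_(n <oo) B z r n a)%E.
have mF : measurable_fun I01 F.
  by apply: ge0_emeasurable_sum => [n a _ _|n _]; [exact: B_ge0|exact: measurable_B].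
have F0 a : (0 <= F a)%E by apply: nneseries_ge0 => n _ _; exact: B_ge0.
have iF : (\int[leb]_(a in I01) F a < +oo)%E.
  rewrite /F integral_nneseries//; last by move=> n; exact: measurable_B.
  apply: (@le_lt_trans _ _ (\sum_(n <oo) (4 * q ^+ n)%:E)%E).
    by apply: lee_nneseries => n *; [apply: integral_ge0 => *; exact: B_ge0|exact: integral_B].
  have q1 : `|q| < 1 by rewrite ger0_norm ?contraction_ge0// contraction_lt1.
  rewrite [ltLHS](_ : _ = (4 / (1 - q))%:E) ?ltry//.
  apply/cvg_lim => //; apply: cvg_EFin; first by apply: nearW => n; rewrite sumEFin.
  rewrite (_ : _ \o _ = series (geometric 4 q)); first exact: cvg_geometric_series.
  by apply/funext => n; rewrite /= sumEFin.
have [a [a01 nEa Fa]] := polar_avoid pE mF F0 iF.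
have c0 n : 0 < (D ^ n)%:R^-1 :> R.
  by rewrite invr_gt0 natrX exprn_gt0// (total_degree_gt0 G_degree G_nonlinear).
have foo n (w : n.-tuple G) : (fiber_error (word w) z r a < +oo)%E.
  have : (B z r n a < +oo)%E.
    apply: le_lt_trans Fa; apply: le_trans (nneseries_lim_ge n.+1 _) => //.
    by rewrite big_nat_recr//= leeDr// sume_ge0.
  (* An infinite error for [w] would make the whole sum at level [n] infinite, the other terms being
     nonnegative. *)
  rewrite /B (bigD1 w)//= ge0_muleDr ?fiber_error_ge0//; last first.
    by apply: sume_ge0 => *; exact: fiber_error_ge0.
  rewrite ltNge => /negP h; rewrite ltNge; apply/negP; rewrite leye_eq => /eqP e.
  apply: h; rewrite e gt0_muley ?lte_fin// leye_eq addye//.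
  rewrite gt_eqF// (@lt_le_trans _ _ 0%:E) ?ltNyr// mule_ge0 ?lee_fin ?(ltW (c0 n))//.
  by apply: sume_ge0 => *; exact: fiber_error_ge0.
exists a; split => //.
have := nneseries_term_cvg0 (fun n => B_ge0 z r n a) Fa.
rewrite (_ : (fun n => B z r n a) = EFin \o (fun n =>
  word_average (fun w : n.-tuple G => fine (fiber_error (word w) z r a)))).
  by move=> /fine_cvgP[].
apply/funext => n /=; rewrite /B /word_average EFinM -sumEFin; congr (_ * _)%E.
by apply: eq_bigr => w _; rewrite fineK// ge0_fin_numE ?fiber_error_ge0.
Qed.

(** The left side involves neither [z] nor [r], so the difference on the right takes the same value
    for all segments. *)
Lemma segment_limit z r (E : set (sphere R)) (V : C -> R) K : 0 < r ->
  polar E -> (forall a, ~ E a -> weak_limit a) -> continuous V ->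
  (forall n y, `|green G n y - V y| <= K * q ^+ n) ->
  leading n @[n --> \oo] -->
    \int[leb]_(x in I01) V (segment z r x) - fine (\int[mu]_x (segment_test z r x)%:E)%E.
Proof.
move=> rp pE wE cV VK.
have [a [a01 nEa foo err0]] := good_fiber z r pE.
pose e n := word_average (fun w : n.-tuple G => fine (fiber_error (word w) z r a)).
have ar0 : cmod (a%:C%C : C) <= r0.
  have /andP[a0 a1] : 0 <= a <= 1 by have := a01; rewrite /= in_itv.
  by rewrite cmod_real ger0_norm// (le_trans a1).
have cT := @continuous_segment_test z r rp.
pose In n := word_average (fun w : n.-tuple G =>
  \sum_(x <- fiber (word w) a%:C%C) segment_test z r (Some x)).
(* The roots have modulus at most [r0], where the cutoff is 1, so the test function reduces to
   [segment_log]. *)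
have InE n : In n = word_average (fun w : n.-tuple G =>
    \int[leb]_(x in I01) ln (cmod ((word w).[segment z r x] - a%:C%C))) - leading n.
  rewrite /In /leading /word_average -mulrBr -sumrB; congr (_ * _); apply: eq_bigr => w _.
  have [_ <-] := integrable_segment_ln_horner a%:C%C z (degree_word G_degree w) rp.
  rewrite !big_seq; apply: eq_bigr => x xf.
  rewrite /segment_test /= cutoff_eq1 ?mulr1//.
  by rewrite (le_trans (fiber_word_bounded ar0 xf))// lerDl.
have Icvg : In n @[n --> \oo] --> fine (\int[mu]_x (segment_test z r x)%:E)%E.
  have := wE _ nEa _ cT.
  rewrite (_ : (fun n => _) = EFin \o In); last first.
    by apply/funext => n; rewrite integral_ds_fiber.
  rewrite -{1}(fineK (integrable_fin_num measurableT (integrable_sphere mu cT))) => H; exact: (fine_cvg H).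
have cgr n : \int[leb]_(x in I01) green G n (segment z r x) =
    word_average (fun w : n.-tuple G => \int[leb]_(x in I01) log_height (word w).[segment z r x]).
  have intw (w : n.-tuple G) : leb.-integrable I01
      (fun x => (log_height (word w).[segment z r x])%:E).
    exact: (@integrable_segment _ (fun y => log_height (word w).[y]) z r
      (@continuous_log_height_horner _ (word w))).
  have [H1 H2] := Rintegral_unit_sum (index_enum (n.-tuple G : finType)) intw.
  by rewrite /green /word_average -H2 RintegralZl.
have bound n : `|leading n - (\int[leb]_(x in I01) V (segment z r x) - In n)| <=
    (ln 3 + K) * q ^+ n + e n.
  rewrite InE; set A := word_average _; set V1 := \int[leb]_(x in I01) V _.
  (* Replacing ln |g_w - a| by the log height costs ln 3 plus the fiber error for each word. *)
  have h1 : `|\int[leb]_(x in I01) green G n (segment z r x) - A| <= ln 3 * q ^+ n + e n.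
    rewrite cgr /A /e /word_average -mulrBr -sumrB normrM ger0_norm ?invr_ge0//.
    apply: (@le_trans _ _ ((D ^ n)%:R^-1 * \sum_(w : n.-tuple G)
        (ln 3 + fine (fiber_error (word w) z r a)))).
      rewrite ler_wpM2l ?invr_ge0// (le_trans (ler_norm_sum _ _ _))//.
      apply: ler_sum => w _.
      by apply: fiber_error_bound => //; exact: degree_word.
    rewrite big_split/= mulrDr lerD2r (le_trans (ler_norm _))//.
    apply: (@word_average_le _ _ G_degree G_nonlinear n (fun=> ln 3)) => w.
    by rewrite ger0_norm// ln_ge0// ler1n.
  have h2 : `|\int[leb]_(x in I01) green G n (segment z r x) - V1| <= K * q ^+ n.
    by apply: segment_average_dist => //; exact: continuous_green.
  move: h1 h2; set g := Rintegral _ _ _; rewrite !ler_norml => /andP[? ?] /andP[? ?].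
  by apply/andP; split; lra.
pose x n := \int[leb]_(x in I01) V (segment z r x) - In n.
have xcvg : x n @[n --> \oo] --> \int[leb]_(x in I01) V (segment z r x) -
    fine (\int[mu]_x (segment_test z r x)%:E)%E.
  by apply: cvgB => //; exact: cvg_cst.
have bcvg : (ln 3 + K) * q ^+ n + e n @[n --> \oo] --> 0.
  rewrite (_ : 0 = (ln 3 + K) * 0 + 0); last by rewrite mulr0 addr0.
  apply: cvgD => //.
  apply: cvgMr; apply: cvg_expr.
  by rewrite ger0_norm ?contraction_ge0// (contraction_lt1 G_degree G_nonlinear).
have ucvg : leading n - x n @[n --> \oo] --> 0.
  have nb : - ((ln 3 + K) * q ^+ n + e n) @[n --> \oo] --> 0.
    by rewrite -oppr0; exact: cvgN.
  apply: squeeze_cvgr nb bcvg; apply: nearW => n.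
  by rewrite -ler_norml; exact: bound.
rewrite (_ : leading = fun n => (leading n - x n) + x n); last first.
  by apply/funext => n; rewrite subrK.
by rewrite -[X in _ --> X]add0r; exact: cvgD ucvg xcvg.
Qed.

End WeakLimit.

(** * From the measure on the sphere to the measure on the plane *)

Section PlanePartIntegral.
Variables (R : realType) (mu : probability (borel (sphere R)) R).
Local Notation C := R[i].
Local Notation sigma := (plane_part mu).
Variable rho : R.
Hypothesis tight : mu [set x : borel (sphere R) | extend0 (cutoff (R := R) rho) x = 0] = 0%E.

Local Notation disc := ([set t : borel C | cmod (t : C) <= rho + 1]).

Let measurable_null : measurable [set x : borel (sphere R) | extend0 (cutoff (R := R) rho) x = 0].
Proof.
have ce : continuous (extend0 (cutoff (R := R) rho)).
  apply: (@continuous_extend0 _ _ (rho + 1)); first exact: continuous_cutoff.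
  exact: cutoff_eq0.
rewrite [X in measurable X](_ : _ = extend0 (cutoff (R := R) rho) @^-1` [set 0])//.
rewrite -[X in measurable X]setTI.
by apply: (borel_measurable_fun ce).
Qed.

Lemma measurable_point_infty : measurable ([set None] : set (borel (sphere R))).
Proof.
rewrite (_ : [set None] = ~` ((Some : C -> sphere R) @` [set: C])); last first.
  apply/seteqP; split => [_ -> [//]|[t|//] /= []]; by exists t.
by apply: measurableC; apply: measurable_plane; exact: measurableT.
Qed.

Lemma null_infty : mu [set None] = 0%E.
Proof.
apply/eqP; rewrite eq_le measure_ge0 andbT -tight; apply: le_measure; rewrite ?inE//.
  exact: measurable_point_infty.
by move=> _ ->.
Qed.

Lemma measurable_disc : measurable disc.
Proof.
rewrite -[X in measurable X]setCK; apply: measurableC; apply: sub_sigma_algebra.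
by apply: closed_openC; exact: closed_disc.
Qed.

Lemma null_disc_compl : sigma (~` disc) = 0%E.
Proof.
apply/eqP; rewrite eq_le measure_ge0 andbT -tight; apply: le_measure; rewrite ?inE//.
  by apply: measurable_plane; apply: measurableC; exact: measurable_disc.
move=> _ [t tr <-] /=; rewrite cutoff_eq0// ltW// ltNge; exact/negP.
Qed.

(** Infinity has measure 0, so its image may be chosen freely; [plane_part] then becomes the
    distribution of a total measurable map. *)
Definition finite_point (x : borel (sphere R)) : borel C := if x is Some t then t else 0.

Lemma measurable_finite_point : measurable_fun setT finite_point.
Proof.
move=> _ A mA; rewrite setTI.
have mS := measurable_plane mA.
have [A0|A0] := pselect (A 0).
  rewrite (_ : _ @^-1` _ = (Some : C -> sphere R) @` A `|` [set None]).
    by apply: measurableU => //; exact: measurable_point_infty.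
  apply/seteqP; split => [[t|] /= h|[t|] /=]; [by left; exists t|by right| |by []].
  by move=> [[u Au [<-]]|].
rewrite (_ : _ @^-1` _ = (Some : C -> sphere R) @` A)//.
apply/seteqP; split => [[t|] /= h|[t|] /=]; [by exists t|by []| |by move=> []].
by move=> [u Au [<-]].
Qed.

HB.instance Definition _ := isMeasurableFun.Build _ _ _ _ _ measurable_finite_point.

Lemma plane_partE (A : set (borel C)) : measurable A ->
  sigma A = distribution mu finite_point A.
Proof.
move=> mA; rewrite /distribution /pushforward /=.
have mS := measurable_plane mA; have mI := measurable_point_infty.
apply/eqP; rewrite eq_le; apply/andP; split.
  apply: le_measure; rewrite ?inE//.
    by rewrite -[X in measurable X]setTI; exact: measurable_finite_point.
  by move=> _ [t At <-].
apply: (@le_trans _ _ (mu ((Some : C -> sphere R) @` A `|` [set None]))).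
  apply: le_measure; rewrite ?inE//.
  - by rewrite -[X in measurable X]setTI; exact: measurable_finite_point.
  - exact: measurableU.
  - by move=> [t|] /= h; [left; exists t|right].
apply: le_trans (measureU2 _ _ _) _ => //.
by rewrite [X in (_ + X)%E]null_infty adde0.
Qed.

Lemma plane_part_setT : sigma setT = 1%E.
Proof. by rewrite plane_partE// probability_setT. Qed.

Lemma integrable_plane_part_cst (D : set (borel C)) (r : R) : measurable D ->
  sigma.-integrable D (fun=> r%:E).
Proof.
move=> mD; apply: (@integrableS _ _ _ sigma setT) => //; apply/integrableP; split => //.
rewrite integral_cst//=.
by rewrite [X in (_ * X)%E](_ : _ = 1%E) ?mule1 ?ltry//; exact: plane_part_setT.
Qed.

Lemma integral_plane_part (f : C -> R) : continuous (extend0 f) -> continuous f ->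
  (\int[sigma]_t (f t)%:E)%E = (\int[mu]_x (extend0 f x)%:E)%E.
Proof.
move=> ce cf.
have mf : measurable_fun setT (fun t : borel C => (f t)%:E).
  by apply/measurable_EFinP; exact: borel_measurable_fun.
have E : ae_eq mu setT (fun x : borel (sphere R) => (extend0 f x)%:E)
   ((fun t : borel C => (f t)%:E) \o finite_point).
  exists [set None]; split; [exact: measurable_point_infty|exact: null_infty|].
  by move=> [t|] //= h; exfalso; apply: h.
have me : measurable_fun setT (fun x : borel (sphere R) => (extend0 f x)%:E).
  by apply/measurable_EFinP; exact: borel_measurable_fun.
have mp : measurable_fun setT ((fun t : borel C => (f t)%:E) \o finite_point).
  exact: measurableT_comp mf measurable_finite_point.
rewrite (eq_measure_integral (distribution mu finite_point)); last first.
  by move=> A mA _; exact: plane_partE.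
rewrite integral_distribution//.
  by apply/esym; apply: ae_eq_integral.
apply/integrableP; split => //; have /integrableP[_] := integrable_sphere mu ce.
congr (_ < _)%E; apply: ae_eq_integral => //; try exact: measurableT_comp.
exists [set None]; split; [exact: measurable_point_infty|exact: null_infty|].
by move=> [t|] //= h; exfalso; apply: h.
Qed.

Lemma integral_disc (f g : borel C -> \bar R) : measurable_fun setT f -> measurable_fun setT g ->
  {in disc, f =1 g} -> (\int[sigma]_(t in disc) f t = \int[sigma]_t g t)%E.
Proof.
move=> mf mg fg; rewrite integral_mkcond; apply: ae_eq_integral => //.
  apply/(measurable_restrictT _ _).1; first exact: measurable_disc.
  exact: measurable_funTS.
exists (~` disc); split; [by apply: measurableC; exact: measurable_disc|exact: null_disc_compl|].
move=> t /= h dt; apply: h => _; rewrite patchE mem_set//; apply: fg.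
by rewrite inE.
Qed.

End PlanePartIntegral.

(** * Shrinking the segment to a point *)

Section PotentialOfLimit.
Variables (R : realType) (mu : probability (borel (sphere R)) R) (rho c : R).
Local Notation C := R[i].
Local Notation sigma := (plane_part mu).
Local Notation leb := (@lebesgue_measure R).
Local Notation I01 := (`[0%R, 1%R]%classic : set R).
Variable V : C -> R.
Hypothesis rho_ge1 : 1 <= rho.
Hypothesis tight : mu [set x : borel (sphere R) | extend0 (cutoff (R := R) rho) x = 0] = 0%E.
Hypothesis continuous_V : continuous V.
Hypothesis segment_identity : forall z r, 0 < r ->
  fine (\int[mu]_x (segment_test rho z r x)%:E)%E =
  \int[leb]_(x in I01) V (segment z r x) - c.

Local Notation disc := ([set t : borel C | cmod (t : C) <= rho + 1]).
Variable z : C.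

Let h n : R := n.+1%:R^-1.
Let h_gt0 n : 0 < h n. Proof. by rewrite invr_gt0 ltr0n. Qed.
Let h_le1 n : h n <= 1. Proof. by rewrite invf_le1// ler1n. Qed.
Let h_cvg0 : h n @[n --> \oo] --> 0. Proof. exact: cvg_harmonic. Qed.

Let z0 : 0 < cmod z + rho + 2.
Proof. by move: rho_ge1; have := cmod_ge0 z; lra. Qed.

(** On the disc, |z - t| <= |z| + rho + 1, and h n <= 1 accounts for the remaining 1; hence [m0]
    bounds [segment_log] there. *)
Let m0 : R := ln (cmod z + rho + 2).

Let g n (t : borel C) : R := m0 - segment_log z (h n) (t : C).

(* The potential kernel shifted so as to be nonnegative on the disc carrying the measure. *)
Let W (t : borel C) : \bar R := (lne (cmod (z - t : C))%:E^-1 + m0%:E)%E.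

Let g_ge n t : m0 - ln (cmod (z - t : C) + h n) <= g n t.
Proof. by rewrite /g lerD2l lerN2; exact: segment_log_le. Qed.

Let g_ge0 n t : disc t -> 0 <= g n t.
Proof.
move=> /= dt; rewrite (le_trans _ (g_ge n t))// subr_ge0 /m0.
have tz : cmod (z - t : C) <= cmod z + (rho + 1).
  by have := cmodB_triangle 0 z t; rewrite subr0 sub0r normcN; lra.
have := h_le1 n; have := h_gt0 n; have := cmod_ge0 (z - t : C); have := cmod_ge0 z => *.
by rewrite ler_ln ?posrE; lra.
Qed.

Let W_le n t : ((g n t)%:E <= W t + 8%:E)%E.
Proof.
have [->|tz] := eqVneq (t : C) z.
  by rewrite /W subrr cmod0 inve0 /= leey.
have d0 : 0 < cmod (z - t : C) by apply: cmod_gt0; rewrite subr_eq0 eq_sym.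
rewrite /W inver gt_eqF// lneV// lne_EFin// -EFinN -!EFinD lee_fin /g.
by have := segment_log_ge (h_gt0 n) d0; lra.
Qed.

(** At t = z, [g n] is at least m0 - ln (h n), which tends to +oo. Elsewhere it is squeezed between
    the logarithms of |z - t| + h n and |z - t| - h n. *)
Let g_cvg t : (g n t)%:E @[n --> \oo] --> W t.
Proof.
have [->|tz] := eqVneq (t : C) z.
  rewrite /W subrr cmod0 inve0 /=; apply/cvgeyPge => A.
  have /cvgrPdist_lt/(_ (expR (m0 - A)) (expR_gt0 _)) := h_cvg0.
  apply: filterS => n; rewrite sub0r normrN ger0_norm ?(ltW (h_gt0 n))// => hA.
  rewrite lee_fin (le_trans _ (g_ge n z))// subrr cmod0 add0r.
  have : ln (h n) < m0 - A by rewrite -ltr_expR lnK ?posrE.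
  by lra.
have d0 : 0 < cmod (z - t : C) by apply: cmod_gt0; rewrite subr_eq0 eq_sym.
rewrite /W inver gt_eqF// lneV// lne_EFin// -EFinN -EFinD addrC.
apply: cvg_EFin; first exact: nearW.
apply: (@squeeze_cvgr _ _ _ _ (fun n => m0 - ln (cmod (z - t : C) + h n))
  (fun n => m0 - ln (cmod (z - t : C) - h n))).
- have /cvgrPdist_lt/(_ _ d0) := h_cvg0; apply: filterS => n.
  rewrite sub0r normrN ger0_norm ?(ltW (h_gt0 n))// => hd.
  by rewrite g_ge/= lerD2l lerN2 segment_log_ge_far.
- apply: cvgB; first exact: cvg_cst.
  have H : cmod (z - t : C) + h n @[n --> \oo] --> cmod (z - t : C).
    by rewrite -[X in _ --> X]addr0; apply: cvgD => //; exact: cvg_cst.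
  exact: (cvg_comp _ _ H (continuous_ln d0)).
- apply: cvgB; first exact: cvg_cst.
  have H : cmod (z - t : C) - h n @[n --> \oo] --> cmod (z - t : C).
    by rewrite -[X in _ --> X]subr0; apply: cvgB => //; exact: cvg_cst.
  exact: (cvg_comp _ _ H (continuous_ln d0)).
Qed.

Let continuous_g n : continuous (g n : C -> R).
Proof.
move=> t; have FF : ProperFilter (nbhs t) by exact: nbhs_pfilter.
by apply: cvgB; [exact: cvg_cst|exact: continuous_segment_log].
Qed.

Let measurable_g n : measurable_fun setT (fun t : borel C => (g n t)%:E).
Proof. by apply/measurable_EFinP; apply: borel_measurable_fun; exact: continuous_g. Qed.

Let measurable_W : measurable_fun setT W.
Proof.
by apply: (emeasurable_fun_cvg (fun n t => (g n t)%:E)) => // t _; exact: g_cvg.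
Qed.

(** On the disc [g n] is [m0] minus the test function, whose integral is given by
    [segment_identity]; the complement of the disc is null. *)
Let integral_g n : (\int[sigma]_(t in disc) (g n t)%:E =
  (m0 + c - \int[leb]_(x in I01) V (segment z (h n) x))%:E)%E.
Proof.
pose T (t : C) := segment_log z (h n) t * cutoff (rho + 1) t.
have cT : continuous T.
  move=> t; have FF : ProperFilter (nbhs t) by exact: nbhs_pfilter.
  by apply: cvgM; [exact: continuous_segment_log|exact: continuous_cutoff].
have ceT : continuous (extend0 T) by exact: continuous_segment_test.
have mT : measurable_fun setT (fun t : borel C => (T t)%:E).
  by apply/measurable_EFinP; exact: borel_measurable_fun.
have fT : (\int[sigma]_t (T t)%:E)%E \is a fin_num.
  rewrite (integral_plane_part tight)//; apply: integrable_fin_num => //.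
  exact: integrable_sphere.
have iT : sigma.-integrable setT (fun t : borel C => (T t)%:E).
  apply/integrableP; split => //; rewrite integral_fin_num_abs//.
  exact/measurable_EFinP.
have iM := integrable_plane_part_cst tight m0 measurableT.
have -> : (\int[sigma]_(t in disc) (g n t)%:E = \int[sigma]_t (m0 - T t)%:E)%E.
  apply: (integral_disc tight); first exact: measurable_g.
    by apply/measurable_EFinP; apply: measurable_funB => //; exact/measurable_EFinP.
  by move=> t; rewrite inE => /= dt; rewrite /g /T cutoff_eq1// mulr1.
under eq_integral do rewrite EFinB.
rewrite integralB_EFin// integral_cst// [X in (_ * X)%E](_ : _ = 1%E); last exact: (plane_part_setT tight).
rewrite mule1 -(fineK fT) -EFinB; congr EFin.
rewrite (integral_plane_part tight)// segment_identity//; ring.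
Qed.

Let average_cvg : \int[leb]_(x in I01) V (segment z (h n) x) @[n --> \oo] --> V z.
Proof.
apply/cvgrPdist_le => e e0.
have /continuous_cmodP/(_ _ e0) [d d0 Vd] := @continuous_V z.
have /cvgrPdist_lt/(_ _ d0) := h_cvg0; apply: filterS => n; rewrite sub0r normrN => hd.
have -> : V z = \int[leb]_(x in I01) (fun=> V z) (segment z (h n) x).
  by rewrite Rintegral_unit_cst.
apply: (@segment_average_dist _ (fun=> V z) V) => //; first by move=> t; exact: cst_continuous.
move=> x x01; apply/ltW/Vd.
have /andP[x0 x1] : 0 <= x <= 1 by have := x01; rewrite /= in_itv.
rewrite cmodBC /segment addrAC subrr add0r cmod_real ger0_norm ?mulr_ge0 ?(ltW (h_gt0 n))//.
by rewrite (le_lt_trans _ hd)// ger0_norm ?(ltW (h_gt0 n))// ler_piMr// (ltW (h_gt0 n)).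
Qed.

Let integral_g_cvg : (\int[sigma]_(t in disc) (g n t)%:E)%E @[n --> \oo] --> (m0 + c - V z)%:E.
Proof.
under eq_fun do rewrite integral_g.
apply: cvg_EFin; first exact: nearW.
by apply: cvgB; [exact: cvg_cst|exact: average_cvg].
Qed.

Let mdisc : measurable disc := measurable_disc rho.

Let W_ge0 t : disc t -> (0 <= W t)%E.
Proof.
move=> dt; have [->|tz] := eqVneq (t : C) z.
  by rewrite /W subrr cmod0 inve0 /= leey.
have d0 : 0 < cmod (z - t : C) by apply: cmod_gt0; rewrite subr_eq0 eq_sym.
rewrite /W inver gt_eqF// lneV// lne_EFin// -EFinN -EFinD lee_fin addrC subr_ge0 /m0.
rewrite ler_ln ?posrE//.
by have := cmodB_triangle 0 z t; rewrite subr0 sub0r normcN; move: dt => /=; lra.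
Qed.

(** Fatou's lemma bounds the integral of [W] by the limit of the integrals of [g n], which is
    finite. No finiteness of the potential is presupposed. *)
Let integrable_W : sigma.-integrable disc W.
Proof.
apply/integrableP; split; first exact: measurable_funTS.
have -> : (\int[sigma]_(t in disc) `|W t| = \int[sigma]_(t in disc) limn_einf (fun n => (g n t)%:E))%E.
  apply: eq_integral => t; rewrite inE => dt; rewrite gee0_abs ?W_ge0//.
  by rewrite is_cvg_limn_einfE; [rewrite (cvg_lim _ (@g_cvg t))|apply/cvg_ex; eexists; exact: g_cvg].
have := @fatou _ _ _ sigma disc mdisc (fun n t => (g n t)%:E)
  (fun n => measurable_funTS (@measurable_g n)) (fun n t dt => g_ge0 n dt).
move=> /le_lt_trans; apply; rewrite is_cvg_limn_einfE; last first.
  by apply/cvg_ex; eexists; exact: integral_g_cvg.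
by rewrite (cvg_lim _ integral_g_cvg)// ltry.
Qed.

(** Once [W] is integrable, W + 8 dominates every [g n], and dominated convergence turns the Fatou
    inequality into an equality. Subtracting [m0] recovers the potential. *)
Lemma potential_of_limit : log_potential sigma z = (c - V z)%:E.
Proof.
have IW8 : sigma.-integrable disc (fun t => (W t + 8%:E)%E).
  by apply: integrableD => //; exact: (integrable_plane_part_cst tight).
have dom n t : disc t -> (`|(g n t)%:E| <= W t + 8%:E)%E.
  by move=> dt; rewrite gee0_abs ?lee_fin ?g_ge0//; exact: W_le.
have [_ _ H] := @dominated_convergence _ _ _ sigma disc mdisc (fun n t => (g n t)%:E) W
  (fun t => (W t + 8%:E)%E) (fun n => measurable_funTS (@measurable_g n))
  (measurable_funTS measurable_W) (aeW _ (fun t _ => @g_cvg t)) IW8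
  (aeW _ (fun t n dt => @dom n t dt)).
have WE : (\int[sigma]_(t in disc) W t = (m0 + c - V z)%:E)%E.
  exact: cvg_unique H integral_g_cvg.
pose L (t : borel C) := lne (cmod (z - t : C))%:E^-1.
have LW t : L t = (W t - m0%:E)%E.
  by rewrite /W addeK.
have mL : measurable_fun setT L.
  rewrite (_ : L = fun t => (W t - m0%:E)%E); last by apply/funext.
  exact: emeasurable_funB.
have iM := integrable_plane_part_cst tight m0 mdisc.
rewrite /log_potential -(integral_disc tight mL mL)//.
rewrite (eq_integral (fun t => (W t - m0%:E)%E)); last by move=> t _; rewrite LW.
rewrite integralB// WE (integral_disc tight (f := fun=> m0%:E) (g := fun=> m0%:E))//.
rewrite integral_cst// [X in (_ * X)%E](_ : _ = 1%E); last exact: (plane_part_setT tight).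
by rewrite mule1 -EFinB; congr EFin; ring.
Qed.

End PotentialOfLimit.

(** * Application to a semigroup and its generators *)

Section DinhSibonyPotential.
Variables (R : realType) (S : set {poly R[i]}) (G : {fset {poly R[i]}}).
Hypothesis HS : polynomial_semigroup S.
Hypothesis HG : generates S G.
Local Notation C := R[i].

Lemma generator_degree g : g \in G -> (0 < degree g)%N.
Proof. by case: HS => _ H _ _ gG; apply: H; apply: HG.1. Qed.

Lemma generator_expanding g : g \in G -> degree g = 1%N -> 1 < cmod (lead_coef g).
Proof. by case: HS => _ _ H _ gG; apply: H; apply: HG.1. Qed.

Lemma generator_nonlinear : exists2 g, g \in G & (2 <= degree g)%N.
Proof.
case: HS => _ _ _ [p Sp p2]; have [w [_ wG pE]] := HG.2 _ Sp.
move: p2; rewrite {p Sp}pE degree_word_comp => p2.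
(* If all generators had degree at most 1, so would every word, degrees being multiplicative. *)
apply: contrapT => nex; move: p2; apply/negP; rewrite -leqNgt.
elim: w wG => [|g w IH] wG; first by rewrite big_nil.
rewrite big_cons -[1%N]muln1 leq_mul//.
  rewrite leqNgt; apply/negP => g2; apply: nex; exists g => //.
  by apply: wG; rewrite inE eqxx.
by apply: IH => h hw; apply: wG; rewrite inE hw orbT.
Qed.

Lemma dinh_sibony_potential (mu : probability (borel (sphere R)) R) :
  dinh_sibony_measure G mu ->
  exists2 u : C -> R, continuous u &
    forall z, log_potential (plane_part mu) z = (u z)%:E.
Proof.
move=> [_ [E [mE pE _ wE]]].
have Gd := generator_degree; have Gn := generator_nonlinear.
have [r r1 Hr] := escape_radius Gd generator_expanding.
have [V [cV [K K0 HV]]] := green_limit Gd Gn.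
have lim z s (s0 : 0 < s) := segment_limit Gd Gn r1 Hr (z := z) s0 pE wE cV HV.
have tight : mu [set x : borel (sphere R) | extend0 (cutoff (R := R) r) x = 0] = 0%E.
  (* With error function 0, this only supplies a point of [0, 1] off the polar set. *)
  have [|a [a01 nEa _]] := @polar_avoid R E (fun=> 0%E) pE (measurable_cst _) (fun=> lexx _).
    by rewrite integral0 ltry.
  apply: (weak_limit_tight Gd Hr (a := a%:C%C)); last exact: wE.
  have /andP[a0 a1] : 0 <= a <= 1 by have := a01; rewrite /= in_itv.
  by rewrite cmod_real ger0_norm// (le_trans a1).
(* One sequence serves all segments, so its limit is a constant valid for every [z] and every
   length. *)
pose c := limn (leading G).
exists (fun z => c - V z).
  move=> z; have FF : ProperFilter (nbhs z) by exact: nbhs_pfilter.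
  by apply: cvgB; [exact: cvg_cst|exact: cV].
move=> z; apply: (potential_of_limit r1 tight cV) => y s s0.
by rewrite /c (cvg_lim _ (lim y s s0))// opprB addrC subrK.
Qed.

End DinhSibonyPotential.

Unset Implicit Arguments.

Theorem theorem6p3 (R : realType) (S : set {poly R[i]})
    (GS : {fset {poly R[i]}})
    (HS : polynomial_semigroup S)
    (HGS : minimal_generating_set S GS)
    (Hcrit : (critical_points GS #= `I_1)%card ->
      [set Some c | c in julia_critical_points S GS] `&` exceptional S = set0)
    (G : {fset {poly R[i]}})
    (HG : generates S G)
    (mu : probability (borel (sphere R)) R)
    (Hmu : dinh_sibony_measure G mu) :
  (forall z : R[i], log_potential (plane_part mu) z \is a fin_num) /\
  continuous (log_potential (plane_part mu)).
Proof.
have [u cu uE] := dinh_sibony_potential HS HG Hmu.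
have -> : log_potential (plane_part mu) = EFin \o u by apply/funext => z; exact: uE.
split=> // z; have FF : ProperFilter (nbhs z) by exact: nbhs_pfilter.
apply: cvg_EFin; [exact: nearW | exact: cu].
Qed.
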